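(* Let $k\in[0,1)$. Suppose that the conductances assigned to edges are $\rho(e)=\mathrm{sc}(\theta_e|k)$ and the masses assigned to vertices are $m^2(x|k)=\sum_{e\ni x}[\mathrm A(\theta_e|k)-\mathrm{sc}(\theta_e|k)]$. Then the model of rooted spanning forests is $Z$-invariant with constant $\mathcal C(k)=k'\,\mathrm{sc}(\theta_1|k)\,\mathrm{sc}(\theta_2|k)\,\mathrm{sc}(\theta_3|k)$. That is, for all finite isoradial graphs $\mathsf G_{Y}$ and $\mathsf G_{\Delta}$ differing by a star-triangle transformation, and for every $\widetilde{\mathsf T}\in\widetilde{\mathcal T}(\mathsf G')$, $$Z(\mathsf G_Y|\widetilde{\mathsf T})=\mathcal C(k)\,Z(\mathsf G_\Delta|\widetilde{\mathsf T}).$$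
   Context: Elliptic notation. $k$ is the elliptic modulus, $k'=\sqrt{1-k^2}$, $K=K(k)=\int_0^{\pi/2}(1-k^2\sin^2\tau)^{-1/2}d\tau$, $E=E(k)=\int_0^{\pi/2}(1-k^2\sin^2\tau)^{1/2}d\tau$. $\mathrm{sc}=\mathrm{sn}/\mathrm{cn}$ and $\mathrm{dc}=\mathrm{dn}/\mathrm{cn}$ are Jacobi elliptic functions of modulus $k$. $\mathrm A(u|k)=\frac1{k'}\left(\int_0^u\mathrm{dc}^2(v|k)\,dv+\frac{E-K}{K}u\right)$. Isoradial graphs. A planar graph $\mathsf G$ is isoradial if it is embedded in the plane so that all internal faces are inscribable in circles of radius $1$ with circumcenters in the interior of the faces; it is given with such an embedding. The diamond graph $\mathsf G^\diamond$ has as vertices those of $\mathsf G$ and the circumcenters; its faces are side-length-$1$ rhombi. Each edge $e$ of $\mathsf G$ is the diagonal of exactly one rhombus, $\overline\theta_e\in(0,\frac\pi2)$ is the half-angle of this rhombus at the vertex it has in common with $e$, and $\theta_e=\overline\theta_e\frac{2K}\pi\in(0,K)$. Star-triangle transformation. $\mathsf G_Y$ contains a star: a vertex $x_0$ of degree $3$ with neighbors $x_1,x_2,x_3$, edge $x_0x_\ell$ having (rescaled) half-angle $\theta_\ell$, with the three rhombi surrounding $x_0$, so $\theta_1+\theta_2+\theta_3=2K$. $\mathsf G_\Delta$ is the isoradial graph obtained by removing $x_0$ and its edges and adding the three edges of the triangle $x_1x_2x_3$; this corresponds to a cubic flip of the three rhombi around $x_0$ in the diamond graph, so the edge $x_ix_j$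 has half-angle $K-\theta_\ell$ for $\{i,j,\ell\}=\{1,2,3\}$. All other edges and half-angles are unchanged. In each of the two graphs, conductances and masses are computed from that graph's own half-angles. Rooted forests as trees, and $Z$-invariance. For a finite graph $\mathsf G$ with conductances $\rho$ and masses $m^2$, $\mathsf G^{\mathsf r}$ is obtained by adding a vertex $\mathsf r$ joined to every vertex of $\mathsf G$, with weights $\rho^m(e)=\rho(e)$ for edges of $\mathsf G$ and $\rho^m(x\mathsf r)=m^2(x)$. Weighted rooted spanning forests of $\mathsf G$ correspond bijectively to spanning trees of $\mathsf G^{\mathsf r}$ weighted by $\prod_e\rho^m(e)$. Let $\mathsf G'$ be the graph obtained from $\mathsf G_Y^{\mathsf r}$ by removing the vertex $x_0$ and the edges $x_ix_0$, $x_i\mathsf r$ ($i=1,2,3$), $x_0\mathsf r$; equivalently it is obtained from $\mathsf G_\Delta^{\mathsf r}$ by removing the edges $x_i\mathsf r$ ($i=1,2,3$) and the three triangle edges. $\widetilde{\mathcal T}(\mathsf G')$ is the set of edge configurations of $\mathsf G'$ that can be extended (by adding removed edges) to spanning trees of $\mathsf G_Y^{\mathsf r}$ and of $\mathsf G_\Delta^{\mathsf r}$. For $\widetilde{\mathsf T}\in\widetilde{\mathcal T}(\mathsf G')$, $Z(\mathsf G_Y|\widetilde{\mathsf T})$ (resp. $Z(\mathsf G_\Delta|\widetilde{\mathsf T})$) is the sum, over all sets $S$ of removed edges such that $\widetilde{\mathsf T}\cup S$ is a spanning tree of $\mathsf G_Y^{\mathsf r}$ (resp. $\mathsf G_\Delta^{\mathsf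 r}$), of $\prod_{e\in S}\rho^m(e)$. The model is $Z$-invariant if there is a constant $\mathcal C$ such that $Z(\mathsf G_Y|\widetilde{\mathsf T})=\mathcal C\,Z(\mathsf G_\Delta|\widetilde{\mathsf T})$ for every $\widetilde{\mathsf T}\in\widetilde{\mathcal T}(\mathsf G')$. *)

(* Defs.v *)
From Stdlib Require Import Reals.
From mathcomp Require Import all_boot all_algebra boolp Rstruct.
From Coquelicot Require Import Coquelicot.

Set Implicit Arguments.
Unset Strict Implicit.
Unset Printing Implicit Defensive.

Local Open Scope R_scope.

(** * Elliptic integrals and Jacobi functions of modulus [k] *)

Definition compl_modulus (k : R) : R := sqrt (1 - k ^ 2).

Definition ellipticF (k phi : R) : R :=
  RInt (fun t => / sqrt (1 - k ^ 2 * sin t ^ 2)) 0 phi.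

Definition ellipticK (k : R) : R := ellipticF k (PI / 2).

Definition ellipticE (k : R) : R :=
  RInt (fun t => sqrt (1 - k ^ 2 * sin t ^ 2)) 0 (PI / 2).

(* The amplitude is the inverse function of [ellipticF k], an increasing
   bijection of the real line when [0 <= k < 1]; [Hierarchy.iota] is
   Coquelicot's definite description, not the [iota] of [seq]. *)
Definition am (k u : R) : R :=
  Hierarchy.iota (fun phi : R => ellipticF k phi = u).

Definition sn (k u : R) : R := sin (am k u).
Definition cn (k u : R) : R := cos (am k u).
Definition dn (k u : R) : R := sqrt (1 - k ^ 2 * sn k u ^ 2).
Definition sc (k u : R) : R := sn k u / cn k u.
Definition dc (k u : R) : R := dn k u / cn k u.

Definition ellA (k u : R) : R :=
  / compl_modulus k *
    (RInt (fun v => dc k v ^ 2) 0 u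
     + (ellipticE k - ellipticK k) / ellipticK k * u).

(** * Plane geometry *)

Definition plane : Type := (R * R)%type.

Definition edist (p q : plane) : R := dist_euc p.1 p.2 q.1 q.2.

(* The unoriented angle [q p r] at the vertex [p], in [0, PI]. *)
Definition angle (q p r : plane) : R :=
  acos (((q.1 - p.1) * (r.1 - p.1) + (q.2 - p.2) * (r.2 - p.2))
        / (edist p q * edist p r)).

(* Nondegenerate rhombus of side length 1 with cyclically ordered corners
   [p], [c], [q], [c'], hence with diagonals [p q] and [c c']. *)
Definition unit_rhombus (p c q c' : plane) : Prop :=
  [/\ edist p c = 1, edist c q = 1, edist q c' = 1 & edist c' p = 1]
  /\ p <> q /\ c <> c'.

Definition in_closure (F : plane -> Prop) (p : plane) : Prop :=
  forall eps : R, 0 < eps -> exists2 q, F q & edist p q < eps.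

Definition bounded_region (F : plane -> Prop) : Prop :=
  exists M : R, forall q, F q -> edist (0, 0) q <= M.

Definition linked_off (D : plane -> Prop) (p q : plane) : Prop :=
  exists g : R -> plane,
    [/\ forall t, 0 <= t <= 1 -> continuous g t /\ ~ D (g t),
        g 0 = p & g 1 = q].

(** * Finite isoradial graphs *)

(* Vertices are taken in an ambient finite type, so that two graphs can share
   vertices; the graphs are simple, an edge being the set of its two ends. *)
Record graph (T : finType) := Graph {
  vertices : {set T};
  edges : {set {set T}};
  edgesP : forall e, e \in edges -> (e \subset vertices) && (#|e| == 2)%N
}.

Section Embedding.
Variables (T : finType) (pos : T -> plane).

Definition on_segment (e : {set T}) (p : plane) : Prop :=
  exists x y t, [/\ e = [set x; y], 0 <= t <= 1
    & p = ((1 - t) * (pos x).1 + t * (pos y).1,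
           (1 - t) * (pos x).2 + t * (pos y).2)].

Definition drawing (G : graph T) (p : plane) : Prop :=
  (exists2 x, x \in vertices G & p = pos x)
  \/ (exists2 e, e \in edges G & on_segment e p).

Definition straight_planar_embedding (G : graph T) : Prop :=
  [/\ {in vertices G &, injective pos},
      forall x e, x \in vertices G -> e \in edges G ->
        on_segment e (pos x) -> x \in e
    & forall e f p, e \in edges G -> f \in edges G -> e <> f ->
        on_segment e p -> on_segment f p ->
        exists x, [/\ x \in e, x \in f & p = pos x]].

(* Faces are the arcwise connected components of the complement of the
   drawing; the internal ones are those that are bounded. *)
Definition face (G : graph T) (F : plane -> Prop) : Prop :=
  exists2 p, ~ drawing G p & forall q, F q <-> linked_off (drawing G) p q.

Definition internal_face (G : graph T) (F : plane -> Prop) : Prop :=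
  face G F /\ bounded_region F.

(* Since faces are open, [F c] says that the circumcenter [c] lies in the
   interior of the face.  The last clause gives every edge its rhombus: it
   follows from the previous one for an edge bordering an internal face, and
   is a condition only on edges with the outer face on both sides. *)
Definition isoradial (G : graph T) : Prop :=
  [/\ straight_planar_embedding G,
      forall F, internal_face G F ->
        exists2 c, F c & forall x, x \in vertices G ->
          in_closure F (pos x) -> edist c (pos x) = 1
    & forall x y, [set x; y] \in edges G ->
        exists c c', unit_rhombus (pos x) c (pos y) c'].

(* Half-angle of the rhombus with diagonal [e], at an end of [e].  The rhombus
   is determined by [e], and the value does not depend on the choices of the
   end [x] of [e] and of the corner [c] of the rhombus. *)
Definition half_angle_bar (e : {set T}) : R :=
  Hierarchy.iota (fun a : R => exists x y c c',
    [/\ e = [set x; y], unit_rhombus (pos x) c (pos y) c'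
      & a = angle (pos y) (pos x) c]).

Definition half_angle (k : R) (e : {set T}) : R :=
  half_angle_bar e * (2 * ellipticK k / PI).

Definition conductance (k : R) (e : {set T}) : R := sc k (half_angle k e).

Definition mass (k : R) (G : graph T) (x : T) : R :=
  (\sum_(e in edges G | x \in e)
     (ellA k (half_angle k e) - sc k (half_angle k e)))%R.

End Embedding.

(** * Rooted spanning forests as spanning trees of the rooted graph *)

(* Edges of the rooted graph: [inl e] is the edge [e] of the graph and [inr x]
   is the edge joining [x] to the root; the root is the vertex [None]. *)
Definition redge (T : finType) : finType := ({set T} + T)%type.

Section Rooted.
Variable T : finType.

Definition rends (f : redge T) : {set option T} :=
  match f with
  | inl e => [set Some x | x in e]
  | inr x => [set Some x; None]
  end.

Definition rvertices (G : graph T) : {set option T} :=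
  None |: [set Some x | x in vertices G].

Definition redges (G : graph T) : {set redge T} :=
  [set inl e | e in edges G] :|: [set inr x | x in vertices G].

Definition radj (S : {set redge T}) : rel (option T) :=
  fun u v => [exists f in S, rends f == [set u; v]].

(* Acyclicity: the cyclic sequences [p] of distinct vertices with consecutive
   ones adjacent have length at most 2 ([:: u; v] just runs an edge back and
   forth). *)
Definition spanning_tree (G : graph T) (S : {set redge T}) : Prop :=
  [/\ S \subset redges G,
      {in rvertices G &, forall u v, connect (radj S) u v}
    & forall p, ucycle (radj S) p -> (size p <= 2)%N].

Definition rweight (rho : {set T} -> R) (m2 : T -> R) (f : redge T) : R :=
  match f with inl e => rho e | inr x => m2 x end.

(* [Zcond G removed w Tt]: the sum over the sets [S] of removed edges completing
   [Tt] into a spanning tree of the rooted graph of [G]. *)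
Definition Zcond (G : graph T) (removed : {set redge T}) (w : redge T -> R)
    (Tt : {set redge T}) : R :=
  (\sum_(S : {set redge T} |
       (S \subset removed) && `[< spanning_tree G (Tt :|: S) >])
     \prod_(f in S) w f)%R.

Definition extendable (G : graph T) (removed Tt : {set redge T}) : Prop :=
  exists2 S : {set redge T}, S \subset removed & spanning_tree G (Tt :|: S).

(** * Star-triangle transformation *)

Definition star_edges (x0 x1 x2 x3 : T) : {set {set T}} :=
  [set [set x0; x1]; [set x0; x2]; [set x0; x3]].

Definition triangle_edges (x1 x2 x3 : T) : {set {set T}} :=
  [set [set x2; x3]; [set x1; x3]; [set x1; x2]].

(* The vertex [x0] of [GY] has exactly the three neighbors [x1], [x2], [x3],
   and is surrounded by the rhombi of its three edges: consecutive ones share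
   a side ([y1], [y2], [y3] being the dual corners), and their angles at [x0]
   add up to [2 * PI].  Apart from [x0], both graphs have the same vertices at
   the same positions. *)
Definition star_triangle (pos : T -> plane) (GY GD : graph T)
    (x0 x1 x2 x3 : T) : Prop :=
  [/\ uniq [:: x0; x1; x2; x3],
      [set e in edges GY | x0 \in e] = star_edges x0 x1 x2 x3,
      exists y1 y2 y3 : plane,
        [/\ unit_rhombus (pos x0) y2 (pos x1) y3,
            unit_rhombus (pos x0) y3 (pos x2) y1,
            unit_rhombus (pos x0) y1 (pos x3) y2
          & 2 * half_angle_bar pos [set x0; x1]
            + 2 * half_angle_bar pos [set x0; x2]
            + 2 * half_angle_bar pos [set x0; x3] = 2 * PI],
      vertices GD = vertices GY :\ x0
    & [disjoint edges GY & triangle_edges x1 x2 x3] /\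
      edges GD = (edges GY :\: star_edges x0 x1 x2 x3)
                   :|: triangle_edges x1 x2 x3].

Definition removed_Y (x0 x1 x2 x3 : T) : {set redge T} :=
  [set inl e | e in star_edges x0 x1 x2 x3]
    :|: [set inr x | x in [set x0; x1; x2; x3]].

Definition removed_D (x1 x2 x3 : T) : {set redge T} :=
  [set inl e | e in triangle_edges x1 x2 x3]
    :|: [set inr x | x in [set x1; x2; x3]].

(* Edges of the common part of the rooted graphs of [GY] and [GD]. *)
Definition common_edges (GY : graph T) (x0 x1 x2 x3 : T) : {set redge T} :=
  redges GY :\: removed_Y x0 x1 x2 x3.

(* Edge configurations of the common part that extend to spanning trees of
   both rooted graphs. *)
Definition reduced_configuration (GY GD : graph T) (x0 x1 x2 x3 : T)
    (Tt : {set redge T}) : Prop :=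
  [/\ Tt \subset common_edges GY x0 x1 x2 x3,
      extendable GY (removed_Y x0 x1 x2 x3) Tt
    & extendable GD (removed_D x1 x2 x3) Tt].

End Rooted.

(* Main.v *)
Require Import Defs.
From Stdlib Require Import Reals Lra Ranalysis5.
From mathcomp Require Import all_boot all_algebra boolp Rstruct.
From Coquelicot Require Import Coquelicot.

(** The rooted star at [x0] is a star with the four ends [x1], [x2], [x3], [r] and
    conductances [a1], [a2], [a3] ([ai = sc thi]) and [m0], the mass of [x0].
    Eliminating its center (star-mesh transformation) divides the partition
    function by [s = a1 + a2 + a3 + m0] and leaves a complete graph on the four
    ends, with conductances [ai aj / s] on [xi xj] and [ai m0 / s] on [xi r].
    These are the conductances and mass increments of the triangle: with
    [th1 + th2 + th3 = 2 K], the addition formula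
      [A (u + v) = A u + A v + k' sc u sc v sc (u + v)]
    at [u = K - th2], [v = K - th3] and the reflection formula
      [A u + A (K - u) = dn u / (k' sn u cn u)]
    give [s = A th1 + A th2 + A th3 = k' a1 a2 a3], while
    [sc (K - u) = 1 / (k' sc u)] gives [sc (K - th3) = a1 a2 / s].
    Conditionally on the configuration outside, only the partition of
    [x1], [x2], [x3], [r] into its connected components matters, so the star-mesh
    identity is checked on each of these partitions. *)

Local Open Scope R_scope.

Set Implicit Arguments.
Unset Strict Implicit.
Unset Printing Implicit Defensive.

(** * Elliptic functions *)

Section Elliptic.
Variable k : R.
Hypothesis hk : 0 <= k < 1.

(** * The incomplete integral [ellipticF] and its inverse, the amplitude *)

Definition delta (t : R) : R := sqrt (1 - k ^ 2 * sin t ^ 2).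

Lemma delta_arg_gt0 t : 0 < 1 - k ^ 2 * sin t ^ 2.
Proof. have := sin2_cos2 t; rewrite /Rsqr; nra. Qed.

Lemma delta_gt0 t : 0 < delta t.
Proof. exact: sqrt_lt_R0 (delta_arg_gt0 t). Qed.

Lemma delta_sqr t : delta t ^ 2 = 1 - k ^ 2 * sin t ^ 2.
Proof. by apply: pow2_sqrt; have := delta_arg_gt0 t; lra. Qed.

Lemma delta_le1 t : delta t <= 1.
Proof.
have := delta_sqr t; have := delta_gt0 t; have := sin2_cos2 t; rewrite /Rsqr; nra.
Qed.

Lemma continuous_delta t : continuous delta t.
Proof.
apply: ex_derive_continuous; rewrite /delta; auto_derive.
by have := delta_arg_gt0 t; rewrite /=; lra.
Qed.

Lemma continuous_inv_delta t : continuous (fun x => / delta x) t.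
Proof.
apply: continuous_comp; first exact: continuous_delta.
apply: continuous_Rinv; have := delta_gt0 t; lra.
Qed.

Lemma is_derive_ellipticF t : is_derive (ellipticF k) t (/ delta t).
Proof.
apply: (is_derive_RInt (fun x => / delta x) _ 0); last exact: continuous_inv_delta.
apply: filter_forall => x; apply: RInt_correct.
by apply: ex_RInt_continuous => z _; exact: continuous_inv_delta.
Qed.

Lemma ellipticF0 : ellipticF k 0 = 0.
Proof. exact: RInt_point. Qed.

Lemma ellipticF_mvt a b : a <= b ->
  exists c, ellipticF k b - ellipticF k a = / delta c * (b - a).
Proof.
move=> ab; have [x _|x _|c [_ ->]] := MVT_gen (ellipticF k) a b (fun c => / delta c).
- exact: is_derive_ellipticF.
- apply: derivable_continuous_pt; exists (/ delta x).
  by apply/is_derive_Reals; exact: is_derive_ellipticF.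
- by exists c.
Qed.

(** The integrand [/ delta c] is at least 1. Injectivity and surjectivity of [ellipticF k], and the
    Lipschitz bound on its inverse, rest on this. *)
Lemma ellipticF_expand a b : a <= b -> b - a <= ellipticF k b - ellipticF k a.
Proof.
move=> ab; have [c ->] := ellipticF_mvt ab.
have : 1 <= / delta c.
  by rewrite -{1}Rinv_1; apply: Rinv_le_contravar; [exact: delta_gt0|exact: delta_le1].
nra.
Qed.

Lemma ellipticF_inj a b : ellipticF k a = ellipticF k b -> a = b.
Proof.
move=> ab; have [ba|ba] := Rle_or_lt a b.
  by have := ellipticF_expand ba; lra.
by have := ellipticF_expand (Rlt_le _ _ ba); lra.
Qed.

Lemma ellipticF_surj u : exists phi, ellipticF k phi = u.
Proof.
have cF : continuity (ellipticF k).
  move=> x; apply: derivable_continuous_pt; exists (/ delta x).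
  by apply/is_derive_Reals; exact: is_derive_ellipticF.
have h1 : ellipticF k (- Rabs u) <= - Rabs u.
  have : - Rabs u <= 0 by have := Rabs_pos u; lra.
  by move/ellipticF_expand; rewrite ellipticF0; lra.
have h2 : Rabs u <= ellipticF k (Rabs u).
  by have := ellipticF_expand (Rabs_pos u); rewrite ellipticF0; lra.
have h3 := Rle_abs u; have h4 := Rle_abs (- u); rewrite Rabs_Ropp in h4.
have [|x [_ hx]] := IVT_gen (ellipticF k) (- Rabs u) (Rabs u) u cF; last by exists x.
rewrite Rmin_left ?Rmax_right; lra.
Qed.

(** [am] is a definite description, so it carries information only once the preimage is known to
    exist and to be unique. *)
Lemma amK u : ellipticF k (am k u) = u.
Proof.
apply: (iota_correct (fun phi : R => ellipticF k phi = u)).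
have [phi hphi] := ellipticF_surj u; exists phi; split=> // psi hpsi.
by apply: ellipticF_inj; rewrite hphi hpsi.
Qed.

Lemma ellipticFK phi : am k (ellipticF k phi) = phi.
Proof. by apply: ellipticF_inj; rewrite amK. Qed.

Lemma am_lipschitz u v : Rabs (am k v - am k u) <= Rabs (v - u).
Proof.
wlog uv : u v / am k u <= am k v => [H|].
  have [/H//|h] := Rle_or_lt (am k u) (am k v).
  rewrite Rabs_minus_sym (Rabs_minus_sym v); apply: H; lra.
have := ellipticF_expand uv; rewrite !amK => h.
rewrite !Rabs_pos_eq; lra.
Qed.

Lemma am_le u v : u <= v -> am k u <= am k v.
Proof.
move=> uv; apply: Rnot_lt_le => h; have := ellipticF_expand (Rlt_le _ _ h).
rewrite !amK; lra.
Qed.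

Lemma am_lt u v : u < v -> am k u < am k v.
Proof.
move=> uv; have [//|h] := am_le (Rlt_le _ _ uv).
by have := amK u; rewrite h amK; lra.
Qed.

Lemma is_derive_am u : is_derive (am k) u (delta (am k u)).
Proof.
have pF a : derivable_pt (ellipticF k) a.
  by exists (/ delta a); apply/is_derive_Reals; exact: is_derive_ellipticF.
have cam : continuity_pt (am k) u.
  apply/continuity_pt_filterlim/filterlim_locally => eps.
  exists eps => v hv.
  by apply: Rle_lt_trans hv; exact: am_lipschitz.
have lbub : u - 1 < u + 1 by lra.
have ulb : u - 1 < u < u + 1 by lra.
have inc : am k (u - 1) <= am k u <= am k (u + 1) by split; apply: am_le; lra.
have D : derive_pt (ellipticF k) (am k u) (pF (am k u)) = / delta (am k u).
  by apply/derive_pt_eq_0/is_derive_Reals; exact: is_derive_ellipticF.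
have dp := delta_gt0 (am k u).
have := @derivable_pt_lim_recip_interv (ellipticF k) (am k) (u - 1) (u + 1) u
  (fun a _ => pF a) cam lbub ulb inc (fun x _ => amK x).
rewrite D => H; apply/is_derive_Reals.
have -> : delta (am k u) = 1 / / delta (am k u) by field; lra.
apply: H; apply: Rinv_neq_0_compat; lra.
Qed.

(** * Algebraic relations and derivatives of [sn], [cn] and [dn] *)

Lemma dnE u : dn k u = delta (am k u).
Proof. by []. Qed.

Lemma sn2_cn2 u : cn k u ^ 2 = 1 - sn k u ^ 2.
Proof. by have := sin2_cos2 (am k u); rewrite /Rsqr /cn /sn; lra. Qed.

Lemma dn_sqr u : dn k u ^ 2 = 1 - k ^ 2 * sn k u ^ 2.
Proof. exact: delta_sqr. Qed.

Lemma dn_gt0 u : 0 < dn k u. Proof. exact: delta_gt0. Qed.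

Lemma is_derive_sn u : is_derive (sn k) u (cn k u * dn k u).
Proof.
have := is_derive_comp _ _ _ _ _ (is_derive_sin (am k u)) (is_derive_am u).
by rewrite /scal /= /mult /= Rmult_comm.
Qed.

Lemma is_derive_cn u : is_derive (cn k) u (- (sn k u * dn k u)).
Proof.
have := is_derive_comp _ _ _ _ _ (is_derive_cos (am k u)) (is_derive_am u).
rewrite /scal /= /mult /= => H.
by have -> : - (sn k u * dn k u) = delta (am k u) * - sin (am k u) by rewrite dnE /sn; ring.
Qed.

Lemma is_derive_dn u : is_derive (dn k) u (- (k ^ 2 * sn k u * cn k u)).
Proof.
have dp := dn_gt0 u.
have E : forall v, sqrt (1 - k ^ 2 * sn k v ^ 2) = dn k v by [].
apply: (is_derive_ext _ _ _ _ E).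
have ds := is_derive_sn u.
auto_derive.
  split; first by exists (cn k u * dn k u).
  by split=> //; have := delta_arg_gt0 (am k u); rewrite -/(sn k u) /=; lra.
rewrite (is_derive_unique _ _ _ ds).
have -> : sqrt (1 + - (k * (k * 1) * (sn k u * (sn k u * 1)))) = dn k u.
  by congr sqrt; ring.
field; lra.
Qed.


(** * Addition theorems for [sn] and [cn] *)

Lemma zero_derivative_const (f : R -> R) :
  (forall t, is_derive f t 0) -> forall a b, f a = f b.
Proof.
move=> df a b; have [ab|[->//|ab]] := Rtotal_order a b.
  by apply: eq_is_derive => // t _; exact: df.
by symmetry; apply: eq_is_derive => // t _; exact: df.
Qed.

Lemma am0 : am k 0 = 0.
Proof. by rewrite -{1}ellipticF0 ellipticFK. Qed.

Lemma sn0 : sn k 0 = 0.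
Proof. by rewrite /sn am0 sin_0. Qed.

Lemma cn0 : cn k 0 = 1.
Proof. by rewrite /cn am0 cos_0. Qed.

Lemma dn0 : dn k 0 = 1.
Proof. by rewrite /dn sn0 -[RHS]sqrt_1; congr sqrt; ring. Qed.

(** Since [sn] has square at most 1 and [k ^ 2 < 1], the common denominator of the addition formulas
    never vanishes. *)
Lemma sn_den_gt0 u v : 0 < 1 - k ^ 2 * sn k u ^ 2 * sn k v ^ 2.
Proof.
have := sn2_cn2 u; have := sn2_cn2 v => h1 h2.
have : sn k u ^ 2 * sn k v ^ 2 <= 1.
  have := pow2_ge_0 (cn k u); have := pow2_ge_0 (cn k v); nra.
have : 0 <= sn k u ^ 2 * sn k v ^ 2 by apply: Rmult_le_pos; apply: pow2_ge_0.
nra.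
Qed.

Ltac jacobi_derive :=
  auto_derive;
  [ repeat split; try by [exact: I | eexists; apply: is_derive_sn
      | eexists; apply: is_derive_cn | eexists; apply: is_derive_dn]
  | rewrite ?(is_derive_unique _ _ _ (is_derive_sn _))
      ?(is_derive_unique _ _ _ (is_derive_cn _))
      ?(is_derive_unique _ _ _ (is_derive_dn _)) ].

(* Euler's method: the right-hand side is constant along [u + v = c], and its
   value at [u = 0] is [sn c]. *)
Lemma sn_addition u v :
  sn k (u + v) = (sn k u * cn k v * dn k v + sn k v * cn k u * dn k u)
                 / (1 - k ^ 2 * sn k u ^ 2 * sn k v ^ 2).
Proof.
pose c := u + v.
pose f t := (sn k t * cn k (c - t) * dn k (c - t) + sn k (c - t) * cn k t * dn k t)
            / (1 - k ^ 2 * sn k t ^ 2 * sn k (c - t) ^ 2).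
have df t : is_derive f t 0.
  have D := sn_den_gt0 t (c - t).
  have H1 := sn2_cn2 t; have H2 := dn_sqr t.
  have H3 := sn2_cn2 (c - t); have H4 := dn_sqr (c - t).
  rewrite /f; jacobi_derive.
    by move: D; change (c + - t) with (c - t); move=> /=; lra.
  change (c + - t) with (c - t).
  (* With the six values turned into free variables, the vanishing of the derivative is a rational
     identity modulo four quadratic relations, which [field] uses as rewriting rules. *)
  move: (sn k t) (cn k t) (dn k t) (sn k (c - t)) (cn k (c - t)) (dn k (c - t))
    H1 H2 H3 H4 D.
  move=> s1 c1 d1 s2 c2 d2 H1 H2 H3 H4 D.
  field [H1 H2 H3 H4].
  lra.
have -> : sn k (u + v) = f 0.
  by rewrite /f Rminus_0_r sn0 cn0 dn0 /c; field.
rewrite (zero_derivative_const df 0 u) /f.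
by have -> : c - u = v by rewrite /c; ring.
Qed.

Lemma cn_addition u v :
  cn k (u + v) = (cn k u * cn k v - sn k u * sn k v * dn k u * dn k v)
                 / (1 - k ^ 2 * sn k u ^ 2 * sn k v ^ 2).
Proof.
pose c := u + v.
pose f t := (cn k t * cn k (c - t) - sn k t * sn k (c - t) * dn k t * dn k (c - t))
            / (1 - k ^ 2 * sn k t ^ 2 * sn k (c - t) ^ 2).
have df t : is_derive f t 0.
  have D := sn_den_gt0 t (c - t).
  have H1 := sn2_cn2 t; have H2 := dn_sqr t.
  have H3 := sn2_cn2 (c - t); have H4 := dn_sqr (c - t).
  rewrite /f; jacobi_derive.
    by move: D; change (c + - t) with (c - t); move=> /=; lra.
  change (c + - t) with (c - t).
  move: (sn k t) (cn k t) (dn k t) (sn k (c - t)) (cn k (c - t)) (dn k (c - t))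
    H1 H2 H3 H4 D.
  move=> s1 c1 d1 s2 c2 d2 H1 H2 H3 H4 D.
  field [H1 H2 H3 H4].
  lra.
have -> : cn k (u + v) = f 0.
  by rewrite /f Rminus_0_r sn0 cn0 dn0 /c; field.
rewrite (zero_derivative_const df 0 u) /f.
by have -> : c - u = v by rewrite /c; ring.
Qed.


(** * Parity and the quarter period [K] *)

Lemma ellipticF_odd phi : ellipticF k (- phi) = - ellipticF k phi.
Proof.
have d t : is_derive (fun t => ellipticF k t + ellipticF k (- t)) t 0.
  have h1 := is_derive_ellipticF t; have h2 := is_derive_ellipticF (- t).
  auto_derive; first by split; [exists (/ delta t)|split=> //; exists (/ delta (- t))].
  rewrite (is_derive_unique _ _ _ h1) (is_derive_unique _ _ _ h2).
  have -> : delta (- t) = delta t by rewrite /delta sin_neg; congr sqrt; ring.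
  ring.
by have := zero_derivative_const d phi 0; rewrite /= Ropp_0 ellipticF0; lra.
Qed.

Lemma am_odd u : am k (- u) = - am k u.
Proof. by rewrite -{1}(amK u) -ellipticF_odd ellipticFK. Qed.

Lemma sn_odd u : sn k (- u) = - sn k u.
Proof. by rewrite /sn am_odd sin_neg. Qed.

Lemma cn_even u : cn k (- u) = cn k u.
Proof. by rewrite /cn am_odd cos_neg. Qed.

Lemma dn_even u : dn k (- u) = dn k u.
Proof. by rewrite /dn sn_odd; congr sqrt; ring. Qed.

Lemma ellipticK_gt0 : 0 < ellipticK k.
Proof.
rewrite /ellipticK; have := PI_RGT_0 => hpi.
have h : 0 <= PI / 2 by lra.
by have := ellipticF_expand h; rewrite ellipticF0; lra.
Qed.

Local Notation K := (ellipticK k).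
Local Notation k' := (compl_modulus k).

Lemma compl_modulus_gt0 : 0 < k'.
Proof. by apply: sqrt_lt_R0; nra. Qed.

Lemma compl_modulus_sqr : k' ^ 2 = 1 - k ^ 2.
Proof. by apply: pow2_sqrt; nra. Qed.

Lemma snK : sn k K = 1.
Proof. by rewrite /sn ellipticFK sin_PI2. Qed.

Lemma cnK : cn k K = 0.
Proof. by rewrite /cn ellipticFK cos_PI2. Qed.

Lemma dnK : dn k K = k'.
Proof. by rewrite /dn snK; congr sqrt; ring. Qed.

Lemma cn_gt0 u : 0 <= u < K -> 0 < cn k u.
Proof.
move=> [u0 uK]; apply: cos_gt_0.
  have := am_le u0; rewrite am0; have := PI_RGT_0; lra.
by have := am_lt uK; rewrite ellipticFK.
Qed.

Lemma sn_gt0 u : 0 < u < K -> 0 < sn k u.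
Proof.
move=> [u0 uK]; apply: sin_gt_0.
  by have := am_lt u0; rewrite am0.
have := am_lt uK; rewrite ellipticFK; have := PI_RGT_0; lra.
Qed.

Lemma sc_gt0 u : 0 < u < K -> 0 < sc k u.
Proof. by move=> hu; apply: Rdiv_lt_0_compat; [exact: sn_gt0|apply: cn_gt0; lra]. Qed.

Lemma sn_compl u : sn k (K - u) = cn k u / dn k u.
Proof.
have dp := dn_gt0 u; rewrite /Rminus sn_addition sn_odd cn_even dn_even snK cnK dnK.
have D := dn_sqr u.
have -> : 1 - k ^ 2 * 1 ^ 2 * (- sn k u) ^ 2 = dn k u ^ 2 by rewrite D; ring.
field; lra.
Qed.

Lemma cn_compl u : cn k (K - u) = k' * sn k u / dn k u.
Proof.
have dp := dn_gt0 u; rewrite /Rminus cn_addition sn_odd cn_even dn_even snK cnK dnK.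
have D := dn_sqr u.
have -> : 1 - k ^ 2 * 1 ^ 2 * (- sn k u) ^ 2 = dn k u ^ 2 by rewrite D; ring.
field; lra.
Qed.

Lemma dn_compl u : dn k (K - u) = k' / dn k u.
Proof.
have dp := dn_gt0 u; have kp := compl_modulus_gt0.
have h : 0 < k' / dn k u by apply: Rdiv_lt_0_compat.
rewrite {1}/dn sn_compl -(sqrt_pow2 (k' / dn k u)); last lra.
congr sqrt; have D := dn_sqr u; have C := sn2_cn2 u; have M := compl_modulus_sqr.
field [M D C]; lra.
Qed.

Lemma sc_compl u : 0 < u < K -> sc k (K - u) = / (k' * sc k u).
Proof.
move=> hu; have := dn_gt0 u; have := sn_gt0 hu; have := compl_modulus_gt0.
have : 0 < cn k u by apply: cn_gt0; lra.
rewrite /sc sn_compl cn_compl => *; field; lra.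
Qed.

(** * Jacobi's epsilon function [ellE], and the reflection and addition formulas of [ellA] *)

Definition ellE (u : R) : R := RInt delta 0 (am k u).

Lemma ellEK : ellE K = ellipticE k.
Proof. by rewrite /ellE ellipticFK. Qed.

Lemma ellE0 : ellE 0 = 0.
Proof. by rewrite /ellE am0; exact: RInt_point. Qed.

Lemma is_derive_ellE u : is_derive ellE u (dn k u ^ 2).
Proof.
have h : is_derive (fun x => RInt delta 0 x) (am k u) (delta (am k u)).
  apply: (is_derive_RInt delta _ 0); last exact: continuous_delta.
  apply: filter_forall => x; apply: RInt_correct.
  by apply: ex_RInt_continuous => z _; exact: continuous_delta.
have := is_derive_comp _ _ _ _ _ h (is_derive_am u).
by rewrite /scal /= /mult /= dnE Rmult_1_r.
Qed.

(** Both [ellE t + ellE (K - t)] and [k ^ 2 * sn * cn / dn] have derivative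
    [dn ^ 2 - k' ^ 2 / dn ^ 2] at [t]; the constant is read off at 0. *)
Lemma ellE_compl u :
  ellE u + ellE (K - u) = ellipticE k + k ^ 2 * sn k u * cn k u / dn k u.
Proof.
pose f t := ellE t + ellE (K - t) - k ^ 2 * sn k t * cn k t / dn k t.
have df t : is_derive f t 0.
  have dp := dn_gt0 t; have e1 := is_derive_ellE t; have e2 := is_derive_ellE (K - t).
  rewrite /f; jacobi_derive.
  - by eexists; exact: e1.
  - by eexists; exact: e2.
  - lra.
  rewrite (is_derive_unique _ _ _ e1) (is_derive_unique _ _ _ e2) dn_compl.
  have D := dn_sqr t; have C := sn2_cn2 t; have M := compl_modulus_sqr.
  field [M D C]; lra.
have := zero_derivative_const df u 0.
rewrite /f Rminus_0_r ellE0 ellEK sn0 cn0 dn0; lra.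
Qed.

(** Comes from an explicit primitive [B] of [dc ^ 2] before the pole at [K]; its term [t] cancels
    the [- K / K * u] in the linear part of [ellA]. *)
Lemma ellA_closed_form u : 0 <= u < K ->
  ellA k u = / k' * (dn k u * sc k u - ellE u + ellipticE k / K * u).
Proof.
move=> hu; have Kp := ellipticK_gt0; have kp := compl_modulus_gt0.
pose B t := t - ellE t + dn k t * sn k t / cn k t.
have dB t : 0 <= t <= u -> is_derive B t (dc k t ^ 2).
  move=> ht; have cp : 0 < cn k t by apply: cn_gt0; lra.
  have e := is_derive_ellE t; rewrite /B; jacobi_derive.
  - by eexists; exact: e.
  - lra.
  rewrite (is_derive_unique _ _ _ e) /dc.
  have D := dn_sqr t; have C := sn2_cn2 t.
  field [D C]; lra.
rewrite /ellA (is_RInt_unique (fun v => dc k v ^ 2) 0 u (B u - B 0)); last first.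
  have u0 : 0 <= u by lra.
  apply: (is_RInt_derive B) => x; rewrite Rmin_left ?Rmax_right // => hx.
    exact: dB.
  have cp : 0 < cn k x by apply: cn_gt0; lra.
  rewrite /dc; apply: ex_derive_continuous; auto_derive.
  repeat split; try lra; eexists; [exact: is_derive_dn|exact: is_derive_cn].
rewrite /B ellE0 sn0 /sc; have cp := cn_gt0 hu; rewrite cn0; field; lra.
Qed.

(** The linear parts add up to [ellipticE k], which cancels the constant in [ellE_compl]; only [sn],
    [cn] and [dn] remain. *)
Lemma ellA_compl u : 0 < u < K ->
  ellA k u + ellA k (K - u) = dn k u / (k' * sn k u * cn k u).
Proof.
move=> hu; rewrite !ellA_closed_form; try lra.
have H := ellE_compl u; have E2 : ellE (K - u) =
  ellipticE k + k ^ 2 * sn k u * cn k u / dn k u - ellE u by lra.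
rewrite E2 sc_compl // dn_compl /sc.
have Kp := ellipticK_gt0; have kp := compl_modulus_gt0; have dp := dn_gt0 u.
have sp := sn_gt0 hu; have cp : 0 < cn k u by apply: cn_gt0; lra.
have D := dn_sqr u; have C := sn2_cn2 u; have M := compl_modulus_sqr.
field [M D C]; lra.
Qed.

(** The denominators of the two addition formulas cancel in the quotient. The first conclusion
    justifies later divisions by the new denominator. *)
Lemma sc_subtraction w u : cn k (w - u) <> 0 ->
  cn k w * cn k u + sn k w * sn k u * dn k w * dn k u <> 0 /\
  sc k (w - u) = (sn k w * cn k u * dn k u - sn k u * cn k w * dn k w)
                 / (cn k w * cn k u + sn k w * sn k u * dn k w * dn k u).
Proof.
have D := sn_den_gt0 w u; rewrite /sc.
have -> : sn k (w - u) = (sn k w * cn k u * dn k u - sn k u * cn k w * dn k w)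
    / (1 - k ^ 2 * sn k w ^ 2 * sn k u ^ 2).
  rewrite /Rminus sn_addition sn_odd cn_even dn_even; field; lra.
have -> : cn k (w - u) = (cn k w * cn k u + sn k w * sn k u * dn k w * dn k u)
    / (1 - k ^ 2 * sn k w ^ 2 * sn k u ^ 2).
  rewrite /Rminus cn_addition sn_odd cn_even dn_even; field; lra.
move: (cn k w * cn k u + _) (_ - sn k u * _ * _) => n m h.
have n0 : n <> 0 by move=> n0; apply: h; rewrite n0 /Rdiv Rmult_0_l.
by split=> //; field; lra.
Qed.

Lemma ellA_addition u v : 0 < u -> 0 < v -> u + v < K ->
  ellA k (u + v) = ellA k u + ellA k v + k' * sc k u * sc k v * sc k (u + v).
Proof.
move=> u0 v0 uvK.
(* Up to the constant contributed by the linear parts, [f t] is [k' * (ellA k (t + v) - ellA k t -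
   k' * sc k t * sc k v * sc k (t + v))]. It does not vary with [t], and its value at 0 gives the
   formula. *)
pose f t := (dn k (t + v) * sn k (t + v) / cn k (t + v) - ellE (t + v))
  - (dn k t * sn k t / cn k t - ellE t)
  - k' ^ 2 * sc k v * (sn k t / cn k t) * (sn k (t + v) / cn k (t + v)).
have df t : 0 <= t <= u -> is_derive f t 0.
  move=> ht; have e1 := is_derive_ellE t; have e2 := is_derive_ellE (t + v).
  have c1 : 0 < cn k t by apply: cn_gt0; lra.
  have c2 : 0 < cn k (t + v) by apply: cn_gt0; lra.
  rewrite /f; jacobi_derive.
  - lra.
  - by eexists; exact: e2.
  - lra.
  - by eexists; exact: e1.
  - lra.
  - lra.
  rewrite (is_derive_unique _ _ _ e1) (is_derive_unique _ _ _ e2).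
  (* Writing [sc k v] as [sc k (t + v - t)] leaves only Jacobi functions at [t] and [t + v], whose
     quadratic relations are then enough for [field]. *)
  have c3 : cn k (t + v - t) <> 0.
    have -> : t + v - t = v by ring.
    have : 0 < cn k v by apply: cn_gt0; lra.
    lra.
  have [h1 h2] := sc_subtraction c3.
  have <- : t + v - t = v by ring.
  rewrite h2.
  have D := dn_sqr t; have C := sn2_cn2 t; have M := compl_modulus_sqr.
  have D' := dn_sqr (t + v); have C' := sn2_cn2 (t + v).
  have -> : t + (t + v - t) = t + v by ring.
  field [M D C D' C']; lra.
have := eq_is_derive f 0 u df u0.
rewrite /f !Rplus_0_l sn0 cn0 ellE0 => H.
have Kp := ellipticK_gt0; have kp := compl_modulus_gt0.
have A w : 0 <= w < K ->
    k' * ellA k w = dn k w * sc k w - ellE w + ellipticE k / K * w.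
  by move=> hw; rewrite ellA_closed_form //; field; lra.
apply: (Rmult_eq_reg_l k'); last lra.
rewrite !Rmult_plus_distr_l !A; try lra.
rewrite /sc in H *; rewrite /Rdiv Rmult_0_l in H *; lra.
Qed.

(** The angle [t1] is the sum of [K - t2] and [K - t3]; the product term of the addition formula is
    rewritten by [sc_compl]. *)
Lemma ellA_star t1 t2 t3 :
  0 < t1 < K -> 0 < t2 < K -> 0 < t3 < K -> t1 + t2 + t3 = 2 * K ->
  ellA k t1 = ellA k (K - t2) + ellA k (K - t3) + sc k t1 / (k' * sc k t2 * sc k t3).
Proof.
move=> h1 h2 h3 h.
have -> : t1 = K - t2 + (K - t3) by lra.
rewrite ellA_addition; try lra.
rewrite (sc_compl h2) (sc_compl h3).
have := sc_gt0 h2; have := sc_gt0 h3; have := compl_modulus_gt0 => p1 p2 p3.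
field; lra.
Qed.

(** Expanding [ellA k t1] by [ellA_star] pairs each remaining [ellA] with its reflection;
    [ellA_compl] then eliminates [ellA], leaving an identity in the Jacobi functions of [t2] and
    [t3]. *)
Lemma ellA_sum t1 t2 t3 :
  0 < t1 < K -> 0 < t2 < K -> 0 < t3 < K -> t1 + t2 + t3 = 2 * K ->
  ellA k t1 + ellA k t2 + ellA k t3 = k' * sc k t1 * sc k t2 * sc k t3.
Proof.
move=> h1 h2 h3 h.
rewrite (ellA_star h1 h2 h3 h).
have A2 := ellA_compl h2; have A3 := ellA_compl h3.
suff : dn k t2 / (k' * sn k t2 * cn k t2) + dn k t3 / (k' * sn k t3 * cn k t3) =
    k' * sc k t1 * sc k t2 * sc k t3 - sc k t1 / (k' * sc k t2 * sc k t3) by lra.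
have kp := compl_modulus_gt0.
(* In the form of a difference, [sc k t1] is expressed by [sc_subtraction] through values at [t2]
   and [t3]; the condition holds because [cn k t1] is positive. *)
have e : t1 = K - t2 - (t3 - K) by lra.
have c1 : cn k (K - t2 - (t3 - K)) <> 0.
  by rewrite -e; have : 0 < cn k t1 by [apply: cn_gt0; lra]; lra.
have [e1 e2] := sc_subtraction c1; move: e1 e2; rewrite -e.
have -> : t3 - K = - (K - t3) by ring.
rewrite sn_odd cn_even dn_even !sn_compl !cn_compl !dn_compl => e1 ->.
have d2 := dn_gt0 t2; have d3 := dn_gt0 t3.
have s2 := sn_gt0 h2; have s3 := sn_gt0 h3.
have c2 : 0 < cn k t2 by apply: cn_gt0; lra.
have c3 : 0 < cn k t3 by apply: cn_gt0; lra.
(* The denominator of [sc k t1] up to a nonzero factor, needed for the side conditions of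
   [field]. *)
have e1' : sn k t2 * sn k t3 * dn k t2 * dn k t3 - cn k t2 * cn k t3 <> 0.
  move=> z; apply: e1.
  have -> : k' * sn k t2 / dn k t2 * (k' * sn k t3 / dn k t3) +
    cn k t2 / dn k t2 * - (cn k t3 / dn k t3) * (k' / dn k t2) * (k' / dn k t3)
    = k' ^ 2 / (dn k t2 * dn k t3) ^ 2 *
      (sn k t2 * sn k t3 * dn k t2 * dn k t3 - cn k t2 * cn k t3) by field; lra.
  by rewrite z; ring.
rewrite /sc.
have D := dn_sqr t2; have C := sn2_cn2 t2; have M := compl_modulus_sqr.
have D' := dn_sqr t3; have C' := sn2_cn2 t3.
field [M D C D' C']; repeat split; try lra.
move=> z; apply: e1'; apply: (Rmult_eq_reg_l (k' ^ 2)); first by lra.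
by apply: pow_nonzero; lra.
Qed.

End Elliptic.

(** * Half-angles of rhombi *)

Lemma edist_sqr (p q : plane) : edist p q ^ 2 = (p.1 - q.1) ^ 2 + (p.2 - q.2) ^ 2.
Proof.
rewrite /edist /dist_euc pow2_sqrt /Rsqr; first ring.
by apply: Rplus_le_le_0_compat; apply: Rle_0_sqr.
Qed.

Lemma edist_ge0 (p q : plane) : 0 <= edist p q.
Proof. exact: sqrt_pos. Qed.

Lemma edistC (p q : plane) : edist p q = edist q p.
Proof. exact: distance_symm. Qed.

Lemma edist_gt0 (p q : plane) : p <> q -> 0 < edist p q.
Proof.
move=> pq; have [//|d0] := edist_ge0 p q; case: pq.
have := edist_sqr p q; rewrite -d0.
case: p q {d0} => [a b] [c d] /= h.
have h1 := pow2_ge_0 (a - c); have h2 := pow2_ge_0 (b - d).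
have e1 : a - c = 0 by apply: Rsqr_0_uniq; rewrite Rsqr_pow2; lra.
have e2 : b - d = 0 by apply: Rsqr_0_uniq; rewrite Rsqr_pow2; lra.
by congr pair; lra.
Qed.

Lemma edist_eq1 (p q : plane) : edist p q = 1 -> (p.1 - q.1) ^ 2 + (p.2 - q.2) ^ 2 = 1.
Proof. by rewrite -edist_sqr => ->; ring. Qed.

(** A rhombus is specified only by its unit sides and distinct opposite corners; that it is a
    parallelogram has to be derived. *)
Lemma unit_rhombus_center (p c q c' : plane) : unit_rhombus p c q c' ->
  p.1 + q.1 = c.1 + c'.1 /\ p.2 + q.2 = c.2 + c'.2.
Proof.
case=> [[/edist_eq1 h1 /edist_eq1 h2 /edist_eq1 h3 /edist_eq1 h4]].
case=> /edist_gt0 d1 /edist_gt0 d2.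
have := edist_sqr p q; have := edist_sqr c c'.
move: (edist p q) (edist c c') d1 d2 => d d' d1 d2.
case: p q c c' h1 h2 h3 h4 => [p1 p2] [q1 q2] [a1 a2] [b1 b2] /= h1 h2 h3 h4 D' D.
have dp : 0 < d ^ 2 by apply: pow_lt.
have dp' : 0 < d' ^ 2 by apply: pow_lt.
(* The sum [a + b - p - q] is orthogonal to both diagonals. *)
pose n1 := a1 + b1 - p1 - q1; pose n2 := a2 + b2 - p2 - q2.
have nm : n1 * (a1 - b1) + n2 * (a2 - b2) = 0 by rewrite /n1 /n2; lra.
have nd : n1 * (p1 - q1) + n2 * (p2 - q2) = 0 by rewrite /n1 /n2; lra.
have md : (p1 - q1) * (a1 - b1) + (p2 - q2) * (a2 - b2) = 0 by lra.
pose det := (p1 - q1) * (a2 - b2) - (p2 - q2) * (a1 - b1).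
(* Lagrange's identity: the diagonals being orthogonal and nonzero, [det] is nonzero, so a vector
   orthogonal to both of them vanishes. *)
have det2 : det ^ 2 = d ^ 2 * d' ^ 2.
  have E : d ^ 2 = _ := D; have E' : d' ^ 2 = _ := D'.
  have -> : d ^ 2 * d' ^ 2
    = det ^ 2 + ((p1 - q1) * (a1 - b1) + (p2 - q2) * (a2 - b2)) ^ 2.
    by rewrite E E' /det; ring.
  by rewrite md; ring.
have det0 : det <> 0 by move=> z; rewrite z in det2; nra.
have e1 : det * n1 = 0.
  have -> : det * n1 = (a2 - b2) * (n1 * (p1 - q1) + n2 * (p2 - q2))
    - (p2 - q2) * (n1 * (a1 - b1) + n2 * (a2 - b2)) by rewrite /det; ring.
  by rewrite nm nd; ring.
have e2 : det * n2 = 0.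
  have -> : det * n2 = (p1 - q1) * (n1 * (a1 - b1) + n2 * (a2 - b2))
    - (a1 - b1) * (n1 * (p1 - q1) + n2 * (p2 - q2)) by rewrite /det; ring.
  by rewrite nm nd; ring.
case: (Rmult_integral _ _ e1) => // z1; case: (Rmult_integral _ _ e2) => // z2.
by move: z1 z2; rewrite /n1 /n2; lra.
Qed.

Lemma unit_rhombus_diagonals (p c q c' : plane) : unit_rhombus p c q c' ->
  (edist p q / 2) ^ 2 + (edist c c' / 2) ^ 2 = 1.
Proof.
move=> h; have [e1 e2] := unit_rhombus_center h.
case: h => [[/edist_eq1 h1 /edist_eq1 h2 /edist_eq1 h3 /edist_eq1 h4]] _.
have := edist_sqr p q; have := edist_sqr c c'.
have -> : c'.1 = p.1 + q.1 - c.1 by lra.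
have -> : c'.2 = p.2 + q.2 - c.2 by lra.
move=> H1 H2.
have -> : (edist p q / 2) ^ 2 + (edist c c' / 2) ^ 2 = (edist p q ^ 2 + edist c c' ^ 2) / 4.
  by field.
rewrite H1 H2.
by lra.
Qed.

Lemma angle_unit_rhombus (p c q c' : plane) : unit_rhombus p c q c' ->
  angle q p c = acos (edist p q / 2).
Proof.
case=> [[d1 /edist_eq1 h2 _ _]] [/edist_gt0 d2 _]; rewrite /angle d1; congr acos.
have h1 := edist_eq1 d1; have D := edist_sqr p q.
have e : (q.1 - p.1) * (c.1 - p.1) + (q.2 - p.2) * (c.2 - p.2) = edist p q ^ 2 / 2.
  by rewrite D; lra.
rewrite e; field; lra.
Qed.

Lemma acos_acute x : 0 < x < 1 -> 0 < acos x < PI / 2.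
Proof.
move=> hx; have [a0 aPI] := acos_bound x; have pi0 := PI_RGT_0.
have cx : cos (acos x) = x by apply: cos_acos; lra.
split.
  have [//|z] := a0; move: cx; rewrite -z cos_0; lra.
apply: Rnot_le_lt => h; have : cos (acos x) <= 0 by apply: cos_le_0; lra.
lra.
Qed.

Lemma acos_compl x y : 0 <= x -> 0 <= y -> x ^ 2 + y ^ 2 = 1 -> acos y = PI / 2 - acos x.
Proof.
move=> x0 y0 h; have xy : -1 <= x <= 1 by nra.
have [a0 aPI] := acos_bound x; have pi0 := PI_RGT_0.
have ha : acos x <= PI / 2.
  apply: Rnot_lt_le => lt; have : cos (acos x) < 0 by apply: cos_lt_0; lra.
  rewrite cos_acos //; lra.
rewrite -(acos_cos (PI / 2 - acos x)); last lra.
rewrite cos_shift sin_acos //; congr acos.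
apply: esym; apply: sqrt_lem_1 => //; rewrite /Rsqr; nra.
Qed.

Section HalfAngle.
Variables (T : finType) (pos : T -> plane).

(** By [angle_unit_rhombus] the angle depends only on the length of the edge, hence not on the
    chosen end or corner; this resolves the definite description. *)
Lemma half_angle_barE x y (c c' : plane) : unit_rhombus (pos x) c (pos y) c' ->
  half_angle_bar pos [set x; y] = acos (edist (pos x) (pos y) / 2).
Proof.
move=> rh.
set P := fun a : R => exists x' y' c c', [/\ [set x; y] = [set x'; y'],
   unit_rhombus (pos x') c (pos y') c' & a = angle (pos y') (pos x') c].
have uP a : P a -> a = acos (edist (pos x) (pos y) / 2).
  case=> x' [y' [d [d' [e rh' ->]]]]; rewrite (angle_unit_rhombus rh').
  have xy' : x' != y' by apply/eqP => z; case: rh' => _ []; rewrite z.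
  have hx : x' \in [set x; y] by rewrite e set21.
  have hy : y' \in [set x; y] by rewrite e set22.
  move: hx hy xy'; rewrite !inE.
  by case/orP => /eqP -> /orP[]/eqP ->; rewrite ?eqxx // edistC.
have exP : exists ! a, P a.
  exists (acos (edist (pos x) (pos y) / 2)); split.
    by exists x, y, c, c'; split=> //; rewrite (angle_unit_rhombus rh).
  by move=> a /uP.
exact: uP (iota_correct P exP).
Qed.

Lemma unit_rhombus_half_diagonal (p c q c' : plane) : unit_rhombus p c q c' ->
  0 < edist p q / 2 < 1.
Proof.
move=> rh; have := unit_rhombus_diagonals rh.
by case: rh => _ [/edist_gt0 d1 /edist_gt0 d2]; nra.
Qed.

Lemma half_angle_bar_acute x y (c c' : plane) : unit_rhombus (pos x) c (pos y) c' ->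
  0 < half_angle_bar pos [set x; y] < PI / 2.
Proof.
move=> rh; rewrite (half_angle_barE rh); apply: acos_acute.
exact: unit_rhombus_half_diagonal rh.
Qed.

(* The edge [x y] is a translate of the diagonal [c c'] of the rhombus of [z w]. *)
Lemma half_angle_bar_flip (x y z w : T) (c c' a a' b : plane) :
  unit_rhombus (pos z) c (pos w) c' ->
  unit_rhombus (pos z) b (pos x) c -> unit_rhombus (pos z) c' (pos y) b ->
  unit_rhombus (pos x) a (pos y) a' ->
  half_angle_bar pos [set x; y] = PI / 2 - half_angle_bar pos [set z; w].
Proof.
move=> rw rx ry rxy; rewrite (half_angle_barE rxy) (half_angle_barE rw).
have D := unit_rhombus_diagonals rw.
have [x1 x2] := unit_rhombus_center rx; have [y1 y2] := unit_rhombus_center ry.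
have -> : edist (pos x) (pos y) = edist c c'.
  rewrite /edist /dist_euc.
  have -> : (pos x).1 - (pos y).1 = c.1 - c'.1 by lra.
  by have -> : (pos x).2 - (pos y).2 = c.2 - c'.2 by lra.
apply: acos_compl => //; have := edist_ge0 (pos z) (pos w); have := edist_ge0 c c'; lra.
Qed.

End HalfAngle.

(** * Spanning trees completing a forest *)

Section AddEdge.
Variable V : finType.
Implicit Types (e : rel V) (u v a b : V).

Definition acyclic e := forall p, ucycle e p -> (size p <= 2)%N.

Definition add_edge e u v : rel V :=
  fun a b => [|| e a b, (a == u) && (b == v) | (a == v) && (b == u)].

Lemma connect_add_edge e u v a b : symmetric e ->
  connect (add_edge e u v) a b =
  [|| connect e a b, connect e a u && connect e v b | connect e a v && connect e u b].
Proof.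
move=> esym; have csym := sym_connect_sym esym.
have sub x y : connect e x y -> connect (add_edge e u v) x y.
  by apply: connect_sub => {}x {}y exy; apply: connect1; rewrite /add_edge exy.
have uv : connect (add_edge e u v) u v by apply: connect1; rewrite /add_edge !eqxx orbT.
have vu : connect (add_edge e u v) v u by apply: connect1; rewrite /add_edge !eqxx !orbT.
apply/idP/idP; last first.
  case/or3P=> [/sub //|/andP[/sub h1 /sub h2]|/andP[/sub h1 /sub h2]].
    exact: connect_trans h1 (connect_trans uv h2).
  exact: connect_trans h1 (connect_trans vu h2).
case/connectP => p hp ->; elim: p a hp => [|c p IH] a /=; first by rewrite connect0.
case/andP => hac /IH {IH}; set z := last c p.
case/or3P: hac => [eac|/andP[/eqP-> /eqP->]|/andP[/eqP-> /eqP->]].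
- have ac := connect1 eac.
  case/or3P=> [h|/andP[h1 h2]|/andP[h1 h2]].
  + by rewrite (connect_trans ac h).
  + by rewrite (connect_trans ac h1) h2 orbT.
  + by rewrite (connect_trans ac h1) h2 !orbT.
- case/or3P=> [h|/andP[h1 h2]|/andP[h1 h2]].
  + by rewrite h connect0 orbT.
  + by rewrite h2 connect0 orbT.
  + by rewrite h2.
- case/or3P=> [h|/andP[h1 h2]|/andP[h1 h2]].
  + by rewrite h connect0 !orbT.
  + by rewrite h2.
  + by rewrite h2 connect0 !orbT.
Qed.

(** The position of the first element of [t] lying in a component serves as a canonical name for
    that component. *)
Lemma find_connect_eq e (t : seq V) u v : symmetric e ->
  u \in t -> v \in t ->
  connect e u v = (find (connect e u) t == find (connect e v) t).
Proof.
move=> esym ut vt; have csym := sym_connect_sym esym.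
apply/idP/eqP => [uv|E]; first by apply: eq_find => w; exact: same_connect.
have hu : has (connect e u) t by apply/hasP; exists u.
have hv : has (connect e v) t by apply/hasP; exists v.
have h1 := nth_find u hu; have h2 := nth_find u hv.
by rewrite csym in h2; rewrite -E in h2; exact: connect_trans h1 h2.
Qed.

Lemma acyclic_sub e e' : subrel e e' -> acyclic e' -> acyclic e.
Proof.
by move=> ee' ac p /andP[cp up]; apply: ac; rewrite /ucycle up (sub_cycle ee').
Qed.

Lemma add_edgeC e u v : add_edge e u v =2 add_edge e v u.
Proof. by move=> a b; rewrite /add_edge; congr (_ || _); exact: orbC. Qed.

Lemma add_edge_off e u v a b : a \notin [:: u; v] -> add_edge e u v a b = e a b.
Proof. by rewrite !inE /add_edge => /norP[/negPf-> /negPf->]; rewrite !orbF. Qed.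

(** A cycle through the new edge, cut open there: between [v] and the final [u] every vertex avoids
    both ends, so no step can use the new edge again. *)
Lemma connect_off_edge e u v c q : symmetric e -> c \notin [:: u; v] ->
  all (fun a => a \notin [:: u; v]) q ->
  add_edge e u v v c -> path (add_edge e u v) c (rcons q u) -> connect e v u.
Proof.
move=> esym cuv quv evc hq.
have evc' : e v c.
  move: evc cuv; rewrite /add_edge !inE => /or3P[//|/andP[_ /eqP->]|/andP[_ /eqP->]];
  by rewrite eqxx ?orbT.
have hq' : path e c (rcons q u).
  elim: q c cuv quv hq {evc evc'} => [|d q IH] c cuv /=; rewrite add_edge_off //.
  by move=> /andP[duv quv] /andP[-> /(IH d duv quv)].
apply/connectP; exists (c :: rcons q u); rewrite /= ?evc' ?last_rcons //.
Qed.

Lemma acyclic_add_edge e u v : symmetric e -> u != v -> ~~ e u v ->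
  acyclic (add_edge e u v) <-> acyclic e /\ ~~ connect e u v.
Proof.
move=> esym uv euv; have csym := sym_connect_sym esym; split=> [ac|[ac nuv] p /andP[cp up]].
  split; first by apply: acyclic_sub ac => a b; rewrite /add_edge => ->.
  apply/negP => /connectP [p hp lp].
  case/shortenP: hp lp => q hq uq _ lq.
  (* The new edge closes the shortened path from [u] to [v] into a cycle; size at most 2 would force
     [u = v] or an edge of [e] between them. *)
  have : (size (u :: q) <= 2)%N.
    apply: ac; rewrite /ucycle uq andbT /= rcons_path -lq.
    rewrite (sub_path _ hq) => [|a b]; last by rewrite /add_edge => ->.
    by rewrite /add_edge !eqxx !orbT.
  case: q hq uq lq => [|c [|d q]] //=.
    by move=> _ _ vu; rewrite vu eqxx in uv.
  by rewrite andbT => euc _ vc; rewrite vc euc in euv.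
case ecp : (cycle e p); first by apply: ac; rewrite /ucycle ecp up.
rewrite leqNgt; apply/negP => sp.
(* A step of the cycle outside [e] can only be the new edge; rotating the cycle to start there
   leaves a path joining its ends within [e]. *)
have [x xp nex] : exists2 x, x \in p & ~~ e x (next p x).
  apply/allPn; apply: contraFN ecp => /allP h.
  by apply: cycle_from_next.
case: (rot_to xp) => i q hq.
have uq : uniq (x :: q) by rewrite -hq rot_uniq.
have cq : cycle (add_edge e u v) (x :: q) by rewrite -hq rot_cycle.
move: sp nex; rewrite -(size_rot i) -(next_rot i up) hq.
case: q uq cq {hq} => [|y [|c q]] //= uq cq _; rewrite eqxx => nex.
case/and3P: cq => exy eyc hq.
case/and3P: uq => /norP[xy /norP[xc xq]] /norP[yc yq] _.
have [ux_vy|uy_vx] : (x = u /\ y = v) \/ (x = v /\ y = u).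
- move: exy; rewrite /add_edge (negPf nex) /=.
  by case/orP => /andP[/eqP-> /eqP->]; [left|right].
- case: ux_vy => ? ?; subst x y.
  case/negP: nuv; rewrite csym; apply: (connect_off_edge esym _ _ eyc hq).
    by rewrite !inE negb_or eq_sym xc eq_sym yc.
  apply/allP => a aq; rewrite !inE negb_or; apply/andP.
  by split; [move: xq|move: yq]; apply: contraNneq => <-.
- case: uy_vx => ? ?; subst x y.
  rewrite add_edgeC in eyc.
  case/negP: nuv; apply: (@connect_off_edge e v u c q esym _ _ eyc).
  + by rewrite !inE negb_or eq_sym xc eq_sym yc.
  + apply/allP => a aq; rewrite !inE negb_or; apply/andP.
    by split; [move: xq|move: yq]; apply: contraNneq => <-.
  + by rewrite (eq_path (add_edgeC e v u)).
Qed.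

End AddEdge.

Lemma big_subsetU1 (R : Type) (idx : R) (op : Monoid.com_law idx) (I : finType)
    (f : I) (A : {set I}) (F : {set I} -> R) : f \notin A ->
  \big[op/idx]_(S : {set I} | S \subset f |: A) F S =
  op (\big[op/idx]_(S : {set I} | S \subset A) F S)
     (\big[op/idx]_(S : {set I} | S \subset A) F (f |: S)).
Proof.
move=> fA; rewrite (bigID (fun S : {set I} => f \notin S)) /=; congr (op _ _).
  apply: eq_bigl => S; apply/andP/idP => [[/subsetP SfA fS]|SA].
    apply/subsetP => x xS; have := SfA x xS; rewrite !inE => /orP[/eqP xf|//].
    by move: fS; rewrite -xf xS.
  split; first exact: subset_trans SA (subsetUr _ _).
  by apply: contra fA; exact: (subsetP SA).
rewrite (reindex_onto (fun S => f |: S) (fun S => S :\ f)) /= => [|S /andP[_]].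
  apply: eq_bigl => S; rewrite negbK setU11 andbT; apply/andP/idP.
    case=> /subsetP SfA /eqP <-; apply/subsetP => x; rewrite !inE => /andP[xf xS].
    by have := SfA x; rewrite !inE (negPf xf) in xS *; exact.
  move=> SA; split; first exact: setUS.
  by rewrite setU1K ?eqxx //; apply: contra fA; exact: (subsetP SA).
by rewrite negbK; exact: setD1K.
Qed.

Lemma big_set3 (M : nmodType) (I : finType) (a b c : I) (F : I -> M) :
  uniq [:: a; b; c] -> (\sum_(i in [set a; b; c]) F i = F a + (F b + F c))%R.
Proof.
rewrite /= !inE => /andP[abc /andP[bc _]].
by rewrite -setUA !big_setU1 ?big_set1 ?inE.
Qed.

Lemma eq_set2 (V : finType) (u v a b : V) :
  ([set u; v] == [set a; b]) = (a == u) && (b == v) || (a == v) && (b == u).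
Proof.
apply/eqP/idP => [e|/orP[]/andP[/eqP-> /eqP->] //]; last exact: setUC.
have : a \in [set u; v] by rewrite e set21.
have : b \in [set u; v] by rewrite e set22.
have : u \in [set a; b] by rewrite -e set21.
have : v \in [set a; b] by rewrite -e set22.
rewrite !inE ![u == _]eq_sym ![v == _]eq_sym.
by case: (a == u); case: (a == v); case: (b == u); case: (b == v).
Qed.

(** * Labelled terminals and deletion-contraction *)

Section RootedGraph.
Variable T : finType.
Implicit Types (G : graph T) (S Tt : {set redge T}) (f : redge T).

(** The rooted graph has no parallel edges, so the ends of an edge outside a configuration are not
    adjacent in that configuration. *)
Lemma rends_inj : injective (@rends T).
Proof.
move=> [e|x] [e'|x'] //=.
- by move/imset_inj => -> //; exact: Some_inj.
- move=> h; have : None \in [set Some x | x in e] by rewrite h set22.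
  by case/imsetP.
- move=> h; have : None \in [set Some x | x in e'] by rewrite -h set22.
  by case/imsetP.
- move=> h; have : Some x \in [set Some x'; None] by rewrite -h set21.
  by rewrite !inE orbF => /eqP [->].
Qed.

Lemma card_rends G f : f \in redges G -> #|rends f| = 2%N.
Proof.
case/setUP => /imsetP [e he ->] /=; last by rewrite cards2.
by rewrite card_imset; [case/andP: (edgesP he) => _ /eqP|exact: Some_inj].
Qed.

Lemma radj_sym S : symmetric (radj S).
Proof. by move=> a b; rewrite /radj setUC. Qed.

Lemma radj_sub S S' : S \subset S' -> subrel (radj S) (radj S').
Proof.
by move=> /subsetP h a b /exists_inP[f fS e]; apply/exists_inP; exists f; first exact: h.
Qed.

Lemma radj_setU1 S f u v : rends f = [set u; v] ->
  radj (f |: S) =2 add_edge (radj S) u v.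
Proof.
move=> fuv a b; apply/exists_inP/idP => [[g]|].
  rewrite !inE => /orP[/eqP->|gS] gab.
    by rewrite /add_edge -eq_set2 -fuv gab orbT.
  by apply/orP; left; apply/exists_inP; exists g.
rewrite /add_edge -eq_set2 -fuv => /orP[/exists_inP[g gS gab]|fab].
  by exists g; rewrite // inE gS orbT.
by exists f; rewrite // setU11.
Qed.

Lemma eq_acyclic (V : finType) (e e' : rel V) : e =2 e' -> acyclic e <-> acyclic e'.
Proof.
move=> ee'; split; apply: acyclic_sub => a b; by rewrite ee'.
Qed.

(* Deletion-contraction: sum over the sets of listed edges that connect the
   terminals without closing a cycle.  An edge is given by the indices of its ends
   in a list of terminals; terminals with equal labels have been identified. *)
Fixpoint forest_sum (es : seq (nat * nat * R)) (lab : seq nat) : R :=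
  match es with
  | [::] => if constant lab then 1 else 0
  | (i, j, w) :: es' =>
      forest_sum es' lab
      + (if nth 0%N lab i == nth 0%N lab j then 0 else
         w * forest_sum es'
               [seq if l == nth 0%N lab j then nth 0%N lab i else l | l <- lab])
  end.

(** The invariant of the deletion-contraction recursion: [Tt] is a forest, every vertex is connected
    to a terminal, and [lab] records which terminals are connected to each other. Thus the labels
    alone decide which edges between terminals complete a spanning tree. *)
Record labelling G (t : seq (option T)) Tt (lab : seq nat) : Prop := Labelling {
  lab_sub : Tt \subset redges G;
  lab_acyclic : acyclic (radj Tt);
  lab_cover : forall v, v \in rvertices G -> exists2 u, u \in t & connect (radj Tt) v u;
  lab_size : size lab = size t;
  labP : forall i j, (i < size t)%N -> (j < size t)%N ->
     connect (radj Tt) (nth None t i) (nth None t j) = (nth 0%N lab i == nth 0%N lab j)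
}.

Lemma labelling_merge G t Tt lab f i j : labelling G t Tt lab -> f \in redges G ->
  f \notin Tt -> (i < size t)%N -> (j < size t)%N ->
  rends f = [set nth None t i; nth None t j] ->
  nth 0%N lab i != nth 0%N lab j ->
  labelling G t (f |: Tt) [seq if l == nth 0%N lab j then nth 0%N lab i else l | l <- lab].
Proof.
move=> [sub ac cov sz lP] fG fTt it jt hf lij; have rsym := radj_sym Tt.
have fij : nth None t i != nth None t j.
  by have := card_rends fG; rewrite hf cards2; case: (_ == _).
have nadj : ~~ radj Tt (nth None t i) (nth None t j).
  apply/exists_inP => -[g gTt]; rewrite -hf => /eqP/rends_inj gf.
  by rewrite -gf gTt in fTt.
have hc := eq_connect (radj_setU1 Tt hf).
split.
- by rewrite subUset sub1set fG.
- apply/(eq_acyclic (radj_setU1 Tt hf))/acyclic_add_edge => //.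
  by split=> //; rewrite lP.
- move=> v /cov [u ut vu]; exists u => //.
  by rewrite hc connect_add_edge // vu.
- by rewrite size_map.
- move=> a b ha hb; rewrite hc connect_add_edge // !lP // !(nth_map 0%N) ?sz //.
  move: lij; move: (nth 0%N lab) => l lij.
  by case: (altP (l a =P l j)) => [->|aj]; case: (altP (l b =P l j)) => [->|bj];
    rewrite ?eqxx //= ?(eq_sym (l j) (l i)) ?(eq_sym (l j) (l b))
      ?(negPf lij) ?(negPf aj) ?(negPf bj) /= ?eqxx ?andbT ?andbF ?orbF.
Qed.

Lemma spanning_tree_labelling G t Tt lab : labelling G t Tt lab ->
  {subset t <= rvertices G} -> (spanning_tree G Tt <-> constant lab).
Proof.
move=> [sub ac cov sz lP] tG; have csym := sym_connect_sym (radj_sym Tt).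
split=> [[_ con _]|clab].
  apply/(constantP 0%N).
  have [/size0nil ->|s0] := posnP (size lab); first by exists 0%N.
  exists (nth 0%N lab 0); apply: (@eq_from_nth _ 0%N); first by rewrite size_nseq.
  move=> i hi; rewrite nth_nseq hi; apply/eqP; rewrite sz in hi s0.
  by rewrite -lP //; apply: con; apply: tG; exact: mem_nth.
split=> // u v /cov [u' u't uu'] /cov [v' v't vv'].
rewrite csym in vv'; apply: connect_trans uu' (connect_trans _ vv').
rewrite -(nth_index None u't) -(nth_index None v't) lP ?index_mem //.
case/(constantP 0%N): clab => x E.
have hx i : (i < size t)%N -> nth 0%N lab i = x by rewrite E nth_nseq sz => ->.
by rewrite !hx ?index_mem.
Qed.

(** Induction on the listed edges, splitting the sets [S] by whether they contain the first edge
    [f]. If its ends have equal labels, [f] closes a cycle and the sets containing it contribute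
    nothing; otherwise the recursion passes to [f |: Tt]. *)
Lemma Zcond_forest_sum G (t : seq (option T)) (w : redge T -> R)
    (r : seq (redge T * (nat * nat))) Tt lab :
  {subset t <= rvertices G} -> uniq (unzip1 r) ->
  (forall p, p \in r -> [/\ p.1 \in redges G, p.1 \notin Tt,
     (p.2.1 < size t)%N, (p.2.2 < size t)%N
     & rends p.1 = [set nth None t p.2.1; nth None t p.2.2]]) ->
  labelling G t Tt lab ->
  Zcond G [set:: unzip1 r] w Tt = forest_sum [seq (p.2, w p.1) | p <- r] lab.
Proof.
move=> tG; rewrite /Zcond; elim: r Tt lab => [|[f [i j]] r IH] Tt lab ur hr labT /=.
  rewrite (eq_bigl (fun S => (S == set0) && constant lab)) => [|S].
    by rewrite big_mkcondr big_pred1_eq big_set0.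
  rewrite set_nil subset0; case: eqP => //= ->; rewrite setU0.
  apply/asboolP/idP; by rewrite (spanning_tree_labelling labT tG).
case/andP: ur => fr ur.
have [/= fG fTt it jt hf] := hr _ (mem_head _ _).
have hr' p : p \in r -> _ := fun pr => hr p (mem_behead (s := _ :: r) pr).
have fr' : f \notin [set:: unzip1 r] by rewrite inE.
rewrite big_mkcondr /= set_cons big_subsetU1 //=; congr (_ + _).
  by rewrite -big_mkcondr /= (IH _ lab).
have nadj : nth 0%N lab i == nth 0%N lab j -> ~ acyclic (radj (f |: Tt)).
  rewrite -(labP labT) // => cij /(eq_acyclic (radj_setU1 Tt hf)) ac.
  have [||_] := (acyclic_add_edge (radj_sym Tt) _ _).1 ac; last by rewrite cij.
  - by have := card_rends fG; rewrite hf cards2; case: (_ == _).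
  - apply/exists_inP => -[g gTt]; rewrite -hf => /eqP/rends_inj gf.
    by rewrite -gf gTt in fTt.
case: ifPn => lij.
  apply: big1 => S _; case: asboolP => // -[_ _ ac]; case: (nadj lij).
  apply: acyclic_sub ac; apply: radj_sub.
  by rewrite subUset subsetUl sub1set !inE eqxx orbT.
rewrite -(IH (f |: Tt)) //; first last.
- exact: labelling_merge.
- move=> p pr; have [h1 h2 h3 h4 h5] := hr' p pr; split=> //.
  rewrite !inE negb_or h2 andbT; apply: contraNneq fr => <-.
  exact: (map_f fst pr).
rewrite big_mkcondr /= (_ : forall a b : R, Rmult a b = (a * b)%R) // GRing.mulr_sumr.
apply: eq_bigr => S Sr.
rewrite [f |: S]setUC setUA (setUC _ [set f]) setUA.
rewrite (setUC S) big_setU1 /=; last by apply: contra fr' => /(subsetP Sr).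
by case: ifP => _; rewrite ?GRing.mulr0 //.
Qed.

(** On a path from [v] to the root in an extension, the part before the first edge of [S] lies in
    [Tt] and ends at a terminal; a path without such an edge ends at the root, itself a terminal. *)
Lemma extendable_cover G (removed : {set redge T}) Tt (t : seq (option T)) v :
  (forall f, f \in removed -> {subset rends f <= t}) -> None \in t ->
  extendable G removed Tt -> v \in rvertices G ->
  exists2 u, u \in t & connect (radj Tt) v u.
Proof.
move=> ht rt [S /subsetP Sr [_ con _]] vG.
have /connectP [p hp lp] : connect (radj (Tt :|: S)) v None.
  by apply: con => //; rewrite /rvertices setU11.
elim: p v {vG con} hp lp => [|c p IH] v /=; first by move=> _ <-; exists None.
case/andP => /exists_inP[f]; rewrite inE => fTS fvc hp lp.
case/orP: fTS => fTS; last first.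
  exists v; last exact: connect0.
  by apply: (ht f (Sr f fTS)); rewrite (eqP fvc) set21.
have [u ut cu] := IH c hp lp; exists u => //; apply: connect_trans cu.
by apply: connect1; apply/exists_inP; exists f.
Qed.

Lemma labelling_prefix G G' (t t' : seq (option T)) Tt lab lab' :
  labelling G (t ++ t') Tt (lab ++ lab') -> size lab = size t ->
  Tt \subset redges G' ->
  (forall v, v \in rvertices G' -> exists2 u, u \in t & connect (radj Tt) v u) ->
  labelling G' t Tt lab.
Proof.
move=> [_ ac _ _ lP] sz sub cov; split=> // i j hi hj.
have := lP i j; rewrite !nth_cat sz hi hj; apply; rewrite size_cat; exact: ltn_addr.
Qed.

End RootedGraph.

(** Indices 0, 1, 2 stand for [x1], [x2], [x3], index 3 for the root and 4 for the center, isolated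
    outside the star. Labelling each terminal by the first one in its component gives the bounds on
    [b], [c], [d], so the 24 cases include every partition of the four ends. *)
Lemma star_mesh (a1 a2 a3 m0 m1 m2 m3 : R) (b c d : nat) :
  let s := a1 + a2 + a3 + m0 in
  s <> 0 -> (b < 2)%N -> (c < 3)%N -> (d < 4)%N ->
  forest_sum [:: (4%N, 0%N, a1); (4%N, 1%N, a2); (4%N, 2%N, a3);
                 (0%N, 3%N, m1); (1%N, 3%N, m2); (2%N, 3%N, m3); (4%N, 3%N, m0)]
             [:: 0%N; b; c; d; 4%N]
  = s * forest_sum
      [:: (1%N, 2%N, a2 * a3 / s); (0%N, 2%N, a1 * a3 / s); (0%N, 1%N, a1 * a2 / s);
          (0%N, 3%N, m1 + a1 * m0 / s); (1%N, 3%N, m2 + a2 * m0 / s);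
          (2%N, 3%N, m3 + a3 * m0 / s)]
      [:: 0%N; b; c; d].
Proof.
move=> s s0.
case: b => [|[|//]] _; case: c => [|[|[|//]]] _; case: d => [|[|[|[|//]]]] _ /=;
  rewrite /s; field; exact: s0.
Qed.

(** * The star-triangle transformation *)

Section StarTriangle.
Variable k : R.
Hypothesis hk : 0 <= k < 1.
Local Notation K := (ellipticK k).
Local Notation k' := (compl_modulus k).

(** The change of mass at [x1], which gains two triangle edges and loses a star edge, is the
    star-mesh conductance from [x1] to the root. The [ellA] terms are eliminated by [ellA_star] on
    the left and by [ellA_sum] on the right. *)
Lemma ellA_star_mass t1 t2 t3 :
  0 < t1 < K -> 0 < t2 < K -> 0 < t3 < K -> t1 + t2 + t3 = 2 * K ->
  (ellA k (K - t2) - sc k (K - t2)) + (ellA k (K - t3) - sc k (K - t3))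
    - (ellA k t1 - sc k t1)
  = sc k t1 * ((ellA k t1 - sc k t1) + (ellA k t2 - sc k t2) + (ellA k t3 - sc k t3))
    / (k' * sc k t1 * sc k t2 * sc k t3).
Proof.
move=> h1 h2 h3 h.
have s1 := sc_gt0 hk h1; have s2 := sc_gt0 hk h2; have s3 := sc_gt0 hk h3.
have kp := compl_modulus_gt0 hk.
have S := ellA_sum hk h1 h2 h3 h; have A1 := ellA_star hk h1 h2 h3 h.
have -> : ellA k t1 - sc k t1 + (ellA k t2 - sc k t2) + (ellA k t3 - sc k t3) =
  k' * sc k t1 * sc k t2 * sc k t3 - sc k t1 - sc k t2 - sc k t3 by lra.
rewrite (sc_compl hk h2) (sc_compl hk h3).
have -> : ellA k (K - t3)
    = ellA k t1 - ellA k (K - t2) - sc k t1 / (k' * sc k t2 * sc k t3).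
  by lra.
field; lra.
Qed.

Variable (T : finType).
Implicit Types (G : graph T) (pos : T -> plane).

Lemma mass_split pos G G' (A B : {set {set T}}) x :
  A \subset edges G -> [disjoint edges G & B] -> edges G' = (edges G :\: A) :|: B ->
  mass pos k G' x =
  mass pos k G x
  + (\sum_(e in B | x \in e) (ellA k (half_angle pos k e) - sc k (half_angle pos k e)))%R
  - (\sum_(e in A | x \in e) (ellA k (half_angle pos k e) - sc k (half_angle pos k e)))%R.
Proof.
move=> AG dB E.
have GB : (edges G :\: A) :\: B = edges G :\: A.
  by apply/setDidPl/disjointWl/dB/subsetDl.
rewrite /mass E.
rewrite (big_setIDcond _ (edges G) A) (big_setIDcond _ (_ :|: B) B) /=.
rewrite setIUl setIid (setIC _ B) setDUl setDv setU0 GB (setIidPr AG).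
have -> : (B :&: (edges G :\: A)) :|: B = B by apply/setUidPr/subsetIl.
rewrite -[GRing.add]/Rplus; ring.
Qed.

Lemma half_angle_bounds pos x y (c c' : plane) : unit_rhombus (pos x) c (pos y) c' ->
  0 < half_angle pos k [set x; y] < K.
Proof.
move=> /half_angle_bar_acute; have Kp := ellipticK_gt0 hk; have pi0 := PI_RGT_0.
rewrite /half_angle; move: (half_angle_bar _ _) => a ha.
have fp : 0 < 2 * K / PI by apply: Rdiv_lt_0_compat; lra.
have e : K = PI / 2 * (2 * K / PI) by field; lra.
split; first by apply: Rmult_lt_0_compat; lra.
rewrite [X in _ < X]e; apply: Rmult_lt_compat_r; lra.
Qed.

(** * Half-angles, conductances and masses of a fixed star-triangle pair *)

Section Configuration.
Variables (pos : T -> plane) (GY GD : graph T) (x0 x1 x2 x3 : T).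
Hypothesis isoD : isoradial pos GD.
Hypothesis hYD : star_triangle pos GY GD x0 x1 x2 x3.

Local Notation t1 := (half_angle pos k [set x0; x1]).
Local Notation t2 := (half_angle pos k [set x0; x2]).
Local Notation t3 := (half_angle pos k [set x0; x3]).

Lemma star_half_angles :
  [/\ 0 < t1 < K, 0 < t2 < K, 0 < t3 < K & t1 + t2 + t3 = 2 * K].
Proof.
have pi0 := PI_RGT_0.
case: hYD => _ _ [y1 [y2 [y3 [r1 r2 r3 S]]]] _ _.
split; try by apply: half_angle_bounds; eassumption.
rewrite /half_angle -!Rmult_plus_distr_r.
have -> : half_angle_bar pos [set x0; x1] + half_angle_bar pos [set x0; x2]
  + half_angle_bar pos [set x0; x3] = PI by lra.
field; lra.
Qed.

Lemma triangle_half_angles :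
  [/\ half_angle pos k [set x2; x3] = K - t1, half_angle pos k [set x1; x3] = K - t2
    & half_angle pos k [set x1; x2] = K - t3].
Proof.
have pi0 := PI_RGT_0.
case: hYD => _ _ [y1 [y2 [y3 [r1 r2 r3 _]]]] _ [_ eD].
have [_ _ rh] := isoD.
(* Isoradiality of [GD] supplies a rhombus for the triangle edge; [half_angle_bar_flip] compares it
   with the three rhombi around [z]. *)
have flip x y z w c c' b : [set x; y] \in edges GD ->
    unit_rhombus (pos z) c (pos w) c' ->
    unit_rhombus (pos z) b (pos x) c -> unit_rhombus (pos z) c' (pos y) b ->
    half_angle pos k [set x; y] = K - half_angle pos k [set z; w].
  move=> /rh [a [a' rxy]] rw rx ry; rewrite /half_angle (half_angle_bar_flip rw rx ry rxy).
  field; lra.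
have tri e : e \in triangle_edges x1 x2 x3 -> e \in edges GD.
  by move=> h; rewrite eD; apply/setUP; right.
split.
- by rewrite setUC; apply: flip r1 r3 r2; apply: tri; rewrite setUC !inE eqxx.
- by apply: flip r2 r1 r3; apply: tri; rewrite !inE eqxx ?orbT.
- by rewrite setUC; apply: flip r3 r2 r1; apply: tri; rewrite setUC !inE eqxx ?orbT.
Qed.

Let a1 := sc k t1.
Let a2 := sc k t2.
Let a3 := sc k t3.
Let s := k' * a1 * a2 * a3.

Let uniq_x : uniq [:: x0; x1; x2; x3]. Proof. by case: hYD. Qed.

Let x_neqE :
  ((x0 == x1) = false) * ((x0 == x2) = false) * ((x0 == x3) = false) *
  ((x1 == x2) = false) * ((x1 == x3) = false) * ((x2 == x3) = false) *
  ((x1 == x0) = false) * ((x2 == x0) = false) * ((x3 == x0) = false) *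
  ((x2 == x1) = false) * ((x3 == x1) = false) * ((x3 == x2) = false).
Proof.
move: uniq_x => /=; rewrite !inE !negb_or.
case/andP=> /and3P[n01 n02 n03] /and3P[/andP[n12 n13] n23 _].
by rewrite ![x1 == x0]eq_sym ![x2 == x0]eq_sym ![x3 == x0]eq_sym ![x2 == x1]eq_sym
  ![x3 == x1]eq_sym ![x3 == x2]eq_sym; do !split; exact: negPf.
Qed.

Lemma star_subset : star_edges x0 x1 x2 x3 \subset edges GY.
Proof. by case: hYD => _ <- _ _ _; apply/subsetP => e; rewrite inE => /andP[]. Qed.

Lemma uniq_star : uniq [:: [set x0; x1]; [set x0; x2]; [set x0; x3]].
Proof.
by rewrite /= !inE !eq_set2 !x_neqE ?andbF.
Qed.

Lemma uniq_triangle : uniq [:: [set x2; x3]; [set x1; x3]; [set x1; x2]].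
Proof.
by rewrite /= !inE !eq_set2 !x_neqE ?andbF.
Qed.

Lemma mass_star_center : mass pos k GY x0
  = (ellA k t1 - a1) + (ellA k t2 - a2) + (ellA k t3 - a3).
Proof.
have E : [set e in edges GY | x0 \in e] = star_edges x0 x1 x2 x3 by case: hYD.
rewrite /mass; under eq_bigl => e do
  rewrite -(in_set (fun e => (e \in edges GY) && (x0 \in e))).
rewrite E big_set3 ?uniq_star //.
by rewrite -[GRing.add]/Rplus -[GRing.opp]/Ropp /a1 /a2 /a3; ring.
Qed.

(** The [sc] terms of the mass cancel the conductances of the star, leaving the sum of the three
    [ellA], which [ellA_sum] evaluates. *)
Lemma center_mass : a1 + a2 + a3 + mass pos k GY x0 = s.
Proof.
have [h1 h2 h3 h] := star_half_angles.
have S := ellA_sum hk h1 h2 h3 h; rewrite mass_star_center /s /a1 /a2 /a3; lra.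
Qed.

Lemma s_gt0 : 0 < s.
Proof.
have [h1 h2 h3 _] := star_half_angles.
have s1 := sc_gt0 hk h1; have s2 := sc_gt0 hk h2; have s3 := sc_gt0 hk h3.
have kp := compl_modulus_gt0 hk.
by rewrite /s /a1 /a2 /a3; do 3![apply: Rmult_lt_0_compat => //].
Qed.

Lemma triangle_conductances :
  [/\ conductance pos k [set x2; x3] = a2 * a3 / s,
      conductance pos k [set x1; x3] = a1 * a3 / s
    & conductance pos k [set x1; x2] = a1 * a2 / s].
Proof.
have [h1 h2 h3 h] := star_half_angles; have [e1 e2 e3] := triangle_half_angles.
have s1 := sc_gt0 hk h1; have s2 := sc_gt0 hk h2; have s3 := sc_gt0 hk h3.
have kp := compl_modulus_gt0 hk.
rewrite /conductance e1 e2 e3 !sc_compl // /s /a1 /a2 /a3; split; field; lra.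
Qed.

Lemma triangle_masses :
  [/\ mass pos k GD x1 = mass pos k GY x1 + a1 * mass pos k GY x0 / s,
      mass pos k GD x2 = mass pos k GY x2 + a2 * mass pos k GY x0 / s
    & mass pos k GD x3 = mass pos k GY x3 + a3 * mass pos k GY x0 / s].
Proof.
have [h1 h2 h3 h] := star_half_angles; have [e1 e2 e3] := triangle_half_angles.
have [_ _ _ _ [dB eD]] := hYD.
have s1 := sc_gt0 hk h1; have s2 := sc_gt0 hk h2; have s3 := sc_gt0 hk h3.
have kp := compl_modulus_gt0 hk.
have M x := @mass_split pos GY GD _ _ x star_subset dB eD.
have m1 := ellA_star_mass h1 h2 h3 h.
have h' : t2 + t1 + t3 = 2 * K by lra.
have m2 := ellA_star_mass h2 h1 h3 h'.
have h'' : t3 + t1 + t2 = 2 * K by lra.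
have m3 := ellA_star_mass h3 h1 h2 h''.
rewrite !M mass_star_center !big_mkcondr /= !big_set3 ?uniq_star ?uniq_triangle //.
rewrite !inE !eqxx !x_neqE /=.
rewrite !GRing.addr0 !GRing.add0r e1 e2 e3.
rewrite -[GRing.add]/Rplus -[GRing.opp]/Ropp.
split; rewrite /s /a1 /a2 /a3.
- etransitivity; last (etransitivity; first exact: (f_equal (Rplus (mass pos k GY x1)) m1)).
    by ring.
  by field; lra.
- etransitivity; last (etransitivity; first exact: (f_equal (Rplus (mass pos k GY x2)) m2)).
    by ring.
  by field; lra.
- etransitivity; last (etransitivity; first exact: (f_equal (Rplus (mass pos k GY x3)) m3)).
    by ring.
  by field; lra.
Qed.

(** The removed edges with the positions of their ends in [tY], in the order used by [star_mesh].
    The center is the last terminal, so that [tD] is a prefix of [tY]. *)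
Let rY : seq (redge T * (nat * nat)) :=
  [:: (inl [set x0; x1], (4%N, 0%N)); (inl [set x0; x2], (4%N, 1%N));
      (inl [set x0; x3], (4%N, 2%N)); (inr x1, (0%N, 3%N)); (inr x2, (1%N, 3%N));
      (inr x3, (2%N, 3%N)); (inr x0, (4%N, 3%N))].

Let rD : seq (redge T * (nat * nat)) :=
  [:: (inl [set x2; x3], (1%N, 2%N)); (inl [set x1; x3], (0%N, 2%N));
      (inl [set x1; x2], (0%N, 1%N)); (inr x1, (0%N, 3%N)); (inr x2, (1%N, 3%N));
      (inr x3, (2%N, 3%N))].

Let tD : seq (option T) := [:: Some x1; Some x2; Some x3; None].
Let tY : seq (option T) := tD ++ [:: Some x0].

Lemma removed_YE : removed_Y x0 x1 x2 x3 = [set:: unzip1 rY].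
Proof.
apply/setP => f; rewrite /removed_Y /star_edges !imsetU !imset_set1 !inE.
by rewrite -!orbA; do 3!congr (_ || _); rewrite orbC -!orbA.
Qed.

Lemma removed_DE : removed_D x1 x2 x3 = [set:: unzip1 rD].
Proof.
apply/setP => f; rewrite /removed_D /triangle_edges !imsetU !imset_set1 !inE.
by rewrite -!orbA.
Qed.

Lemma uniq_rY : uniq (unzip1 rY).
Proof.
have inlE (e e' : {set T}) : (inl e == inl e' :> redge T) = (e == e') by [].
have inrE (x y : T) : (inr x == inr y :> redge T) = (x == y) by [].
by rewrite /= !inE !inlE !inrE !eq_set2 !x_neqE ?andbF.
Qed.

Lemma uniq_rD : uniq (unzip1 rD).
Proof.
have inlE (e e' : {set T}) : (inl e == inl e' :> redge T) = (e == e') by [].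
have inrE (x y : T) : (inr x == inr y :> redge T) = (x == y) by [].
by rewrite /= !inE !inlE !inrE !eq_set2 !x_neqE ?andbF.
Qed.

Lemma rends_rY p : p \in rY ->
  [/\ (p.2.1 < size tY)%N, (p.2.2 < size tY)%N
    & rends p.1 = [set nth None tY p.2.1; nth None tY p.2.2]].
Proof.
have : all (fun p => [&& (p.2.1 < size tY)%N, (p.2.2 < size tY)%N
    & rends p.1 == [set nth None tY p.2.1; nth None tY p.2.2]]) rY.
  by rewrite /= !imsetU !imset_set1 !eqxx.
by move/allP => h /h /and3P[? ? /eqP ?].
Qed.

Lemma rends_rD p : p \in rD ->
  [/\ (p.2.1 < size tD)%N, (p.2.2 < size tD)%N
    & rends p.1 = [set nth None tD p.2.1; nth None tD p.2.2]].
Proof.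
have : all (fun p => [&& (p.2.1 < size tD)%N, (p.2.2 < size tD)%N
    & rends p.1 == [set nth None tD p.2.1; nth None tD p.2.2]]) rD.
  by rewrite /= !imsetU !imset_set1 !eqxx.
by move/allP => h /h /and3P[? ? /eqP ?].
Qed.

Lemma star_vertices : {subset [:: x0; x1; x2; x3] <= vertices GY}.
Proof.
have h e x : e \in star_edges x0 x1 x2 x3 -> x \in e -> x \in vertices GY.
  by move=> /(subsetP star_subset) /edgesP /andP[/subsetP h _] /h.
move=> x; rewrite !inE => /or4P[]/eqP->.
- by apply: (h [set x0; x1]); rewrite ?set21 // !inE eqxx.
- by apply: (h [set x0; x1]); rewrite ?set22 // !inE eqxx.
- by apply: (h [set x0; x2]); rewrite ?set22 // !inE eqxx ?orbT.
- by apply: (h [set x0; x3]); rewrite ?set22 // !inE eqxx ?orbT.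
Qed.

Lemma removed_Y_sub : removed_Y x0 x1 x2 x3 \subset redges GY.
Proof.
apply: setUSS; apply: imsetS; first exact: star_subset.
by apply/subsetP => x hx; apply: star_vertices; move: hx; rewrite !inE -!orbA.
Qed.

Lemma removed_D_sub : removed_D x1 x2 x3 \subset redges GD.
Proof.
case: hYD => _ _ _ eV [_ eE].
apply: setUSS; apply: imsetS; first by rewrite eE subsetUr.
apply/subsetP => x hx; rewrite eV !inE; apply/andP; split.
  by move: hx; rewrite !inE -!orbA => /or3P[]/eqP->; rewrite x_neqE.
by apply: star_vertices; move: hx; rewrite !inE -!orbA => ->; rewrite orbT.
Qed.

(** * The configuration outside the star and the triangle *)

Variable Tt : {set redge T}.
Hypothesis hTt : reduced_configuration GY GD x0 x1 x2 x3 Tt.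

Lemma Tt_sub_Y : Tt \subset redges GY.
Proof. by case: hTt => h _ _; apply: subset_trans h (subsetDl _ _). Qed.

Lemma Tt_removed_Y f : f \in removed_Y x0 x1 x2 x3 -> f \notin Tt.
Proof.
move=> fr; case: hTt => /subsetP h _ _; apply/negP => /h.
by rewrite inE fr.
Qed.

Lemma Tt_sub_D : Tt \subset redges GD.
Proof.
case: hYD => _ _ _ eV [_ eE].
apply/subsetP => f fT; have := subsetP Tt_sub_Y f fT.
have fr : f \notin removed_Y x0 x1 x2 x3 by apply: contraL fT; exact: Tt_removed_Y.
case/setUP => /imsetP[z zG fz]; rewrite fz in fr *; apply/setUP.
  left; apply: imset_f; rewrite eE; apply/setUP; left; apply/setDP; split=> //.
  by apply: contra fr => zs; apply/setUP; left; exact: imset_f.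
right; apply: imset_f; rewrite eV !inE zG andbT.
by apply: contra fr => /eqP ->; apply/setUP; right; apply: imset_f; rewrite !inE eqxx.
Qed.

(** Triangle edges are absent from [GY] by the disjointness clause, and the root edges of [x1],
    [x2], [x3] are removed from both graphs. *)
Lemma Tt_removed_D f : f \in removed_D x1 x2 x3 -> f \notin Tt.
Proof.
case/setUP => /imsetP[z hz ->]; last first.
  apply: Tt_removed_Y; apply/setUP; right; apply: imset_f.
  by move: hz; rewrite !inE -!orbA => ->; rewrite orbT.
apply/negP => /(subsetP Tt_sub_Y) /setUP[] /imsetP[w hw] // [zw]; subst w.
by case: hYD => _ _ _ _ [/pred0P/(_ z)]; rewrite /= hw hz.
Qed.

(** All edges at [x0], including the one to the root, are among those removed. *)
Lemma center_isolated v : connect (radj Tt) (Some x0) v = (v == Some x0).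
Proof.
apply/idP/eqP => [|->]; last exact: connect0.
case/connectP => -[|w p] //= /andP[/exists_inP[f fT /eqP fx] _] _.
have := subsetP Tt_sub_Y f fT.
have fr : f \notin removed_Y x0 x1 x2 x3 by apply: contraL fT; exact: Tt_removed_Y.
have xf : Some x0 \in rends f by rewrite fx set21.
case/setUP => /imsetP[z zG fz]; rewrite fz in fr xf; case/negP: fr; apply/setUP.
  left; apply: imset_f; case: hYD => _ <- _ _ _; rewrite inE zG.
  by case/imsetP: xf => y yz [->].
by right; apply: imset_f; move: xf; rewrite !inE orbF => /eqP[->]; rewrite eqxx.
Qed.

Lemma Tt_labelling : exists b c d, [/\ (b < 2)%N, (c < 3)%N, (d < 4)%N
  & labelling GY tY Tt [:: 0%N; b; c; d; 4%N] /\ labelling GD tD Tt [:: 0%N; b; c; d]].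
Proof.
have rsym := radj_sym Tt; have csym := sym_connect_sym rsym.
(* A terminal is found at its own position at the latest, which bounds the labels; the isolated
   center gets 4, its own position. *)
pose lab v := find (connect (radj Tt) v) tY.
have l0 : lab (Some x1) = 0%N by rewrite /lab /= connect0.
have l1 : (lab (Some x2) < 2)%N by rewrite /lab /= connect0; case: ifP.
have l2 : (lab (Some x3) < 3)%N by rewrite /lab /= connect0; do 2!case: ifP => // _.
have l3 : (lab None < 4)%N by rewrite /lab /= connect0; do 3!case: ifP => // _.
have l4 : lab (Some x0) = 4%N.
  rewrite /lab /= !center_isolated eqxx.
  have SE (x y : T) : (Some x == Some y) = (x == y) by [].
  by rewrite !SE !x_neqE.
have LY : labelling GY tY Tt [:: 0%N; lab (Some x2); lab (Some x3); lab None; 4%N].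
  split=> //.
  - exact: Tt_sub_Y.
  - case: hTt => _ [S _ [_ _ ac]] _; apply: acyclic_sub ac.
    exact: radj_sub (subsetUl _ _).
  - move=> v; apply: (extendable_cover (removed := removed_Y x0 x1 x2 x3)).
    + move=> f; rewrite removed_YE inE => /mapP[p /rends_rY[h1 h2 h3] ->] u.
      by rewrite h3 in_set2 => /orP[]/eqP->; exact: mem_nth.
    + by rewrite !inE.
    + by case: hTt.
  - move=> i j hi hj; rewrite (find_connect_eq (t := tY)) ?mem_nth //.
    have -> : [:: 0%N; lab (Some x2); lab (Some x3); lab None; 4%N] = map lab tY.
      by rewrite /= l0 l4.
    by rewrite !(nth_map None).
exists (lab (Some x2)), (lab (Some x3)), (lab None); split=> //; split=> //.
apply: (@labelling_prefix T GY GD tD [:: Some x0] Tt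
  [:: 0%N; _; _; _] [:: 4%N] LY) => //.
  exact: Tt_sub_D.
move=> v; apply: (extendable_cover (removed := removed_D x1 x2 x3)).
- move=> f; rewrite removed_DE inE => /mapP[p /rends_rD[h1 h2 h3] ->] u.
  by rewrite h3 in_set2 => /orP[]/eqP->; exact: mem_nth.
- by rewrite !inE.
- by case: hTt.
Qed.

Lemma Zcond_star_triangle :
  Zcond GY (removed_Y x0 x1 x2 x3) (rweight (conductance pos k) (mass pos k GY)) Tt
  = s * Zcond GD (removed_D x1 x2 x3) (rweight (conductance pos k) (mass pos k GD)) Tt.
Proof.
have [b [c [d [hb hc hd [LY LD]]]]] := Tt_labelling.
have vD : {subset tD <= rvertices GD}.
  case: hYD => _ _ _ eV _ u.
  rewrite !inE => /or4P[]/eqP-> //; apply/orP; right; apply: imset_f;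
    by rewrite eV !inE x_neqE /=; apply: star_vertices; rewrite !inE eqxx ?orbT.
have vY : {subset tY <= rvertices GY}.
  move=> u; rewrite mem_cat => /orP[/vD|].
    case: hYD => _ _ _ eV _; rewrite !inE eV => /orP[->//|/imsetP[x]].
    by rewrite !inE => /andP[_ hx] ->; rewrite imset_f ?orbT.
  rewrite !inE => /eqP->; rewrite imset_f ?orbT //; apply: star_vertices.
  by rewrite !inE eqxx.
rewrite removed_YE removed_DE (Zcond_forest_sum _ vY uniq_rY _ LY); last first.
  move=> p hp; have [h1 h2 h3] := rends_rY hp; have hf : p.1 \in removed_Y x0 x1 x2 x3.
    by rewrite removed_YE inE; apply: map_f.
  by split=> //; [exact: (subsetP removed_Y_sub)|exact: Tt_removed_Y].
rewrite (Zcond_forest_sum _ vD uniq_rD _ LD); last first.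
  move=> p hp; have [h1 h2 h3] := rends_rD hp; have hf : p.1 \in removed_D x1 x2 x3.
    by rewrite removed_DE inE; apply: map_f.
  by split=> //; [exact: (subsetP removed_D_sub)|exact: Tt_removed_D].
have [c1 c2 c3] := triangle_conductances; have [m1 m2 m3] := triangle_masses.
(* [q] is the total conductance at the center in the shape that [star_mesh] expects; [center_mass]
   identifies it with [s]. *)
pose M := mass pos k GY; pose q := a1 + a2 + a3 + M x0.
have -> : [seq (p.2, rweight (conductance pos k) M p.1) | p <- rY] =
  [:: (4%N, 0%N, a1); (4%N, 1%N, a2); (4%N, 2%N, a3); (0%N, 3%N, M x1);
      (1%N, 3%N, M x2); (2%N, 3%N, M x3); (4%N, 3%N, M x0)] by [].
have -> : [seq (p.2, rweight (conductance pos k) (mass pos k GD) p.1) | p <- rD] =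
  [:: (1%N, 2%N, a2 * a3 / q); (0%N, 2%N, a1 * a3 / q); (0%N, 1%N, a1 * a2 / q);
      (0%N, 3%N, M x1 + a1 * M x0 / q); (1%N, 3%N, M x2 + a2 * M x0 / q);
      (2%N, 3%N, M x3 + a3 * M x0 / q)].
  by rewrite /= c1 c2 c3 m1 m2 m3 /q /M center_mass.
rewrite -center_mass -/M; apply: star_mesh => //.
by rewrite center_mass; have := s_gt0; lra.
Qed.

End Configuration.
End StarTriangle.

Theorem theorem41 (k : R) (hk : 0 <= k < 1) (T : finType) (pos : T -> plane)
    (GY GD : graph T) (x0 x1 x2 x3 : T)
    (isoY : isoradial pos GY) (isoD : isoradial pos GD)
    (hYD : star_triangle pos GY GD x0 x1 x2 x3) (Tt : {set redge T})
    (hTt : reduced_configuration GY GD x0 x1 x2 x3 Tt) :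
  Zcond GY (removed_Y x0 x1 x2 x3)
    (rweight (conductance pos k) (mass pos k GY)) Tt
  = compl_modulus k * sc k (half_angle pos k [set x0; x1])
      * sc k (half_angle pos k [set x0; x2])
      * sc k (half_angle pos k [set x0; x3])
    * Zcond GD (removed_D x1 x2 x3)
        (rweight (conductance pos k) (mass pos k GD)) Tt.
Proof. exact: Zcond_star_triangle. Qed.
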